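(* Let $\Gamma$ be an additive Abelian group of finite order $k$ and let $G$ be a connected unbalanced signed graph with $n$ vertices and $m$ edges and with a fixed orientation $D$. Let $T$ be a spanning tree of $G$ consisting of positive edges, let $e_0\in E_N$ be a negative edge, let $T_0=T+e_0$ and $\overline{T}_0=E(G)\setminus E(T_0)$. Let $\mathbf g$ and $\mathbf f_e$ ($e\in\overline{T}_0$) be the vectors associated with the fundamental root circuit and the fundamental circuits, and let ${\cal S}_G$ be the set of all $\Gamma$-flows (not necessarily nowhere-zero) in $G$, i.e. the set of all flows $\gamma\mathbf g+\sum_{e\in\overline{T}_0}\gamma_e\mathbf f_e$ with $\gamma\in\Gamma_2$ and $\gamma_e\in\Gamma$. Then: 1) These flows are pairwise distinct, that is, $\gamma\mathbf g+\sum_{e\in\overline{T}_0}\gamma_e\mathbf f_e=\gamma'\mathbf g+\sum_{e\in\overline{T}_0}\gamma'_e\mathbf f_e$ (with $\gamma,\gamma'\in\Gamma_2$, $\gamma_e,\gamma_e'\in\Gamma$) only if $\gamma=\gamma'$ and $\gamma_e=\gamma'_e$ for all $e\in\overline{T}_0$; therefore $$|{\cal S}_G|=2^{\epsilon(\Gamma)}k^{m-n}.$$ 2) ${\cal S}_G$ is evenly partitioned into $|\Gamma_2|$ classes specified by the elements of $\Gamma_2$: ${\cal S}_G=\bigcup_{\gamma\in\Gamma_2}{\cal S}_G(\gamma)$ is a disjoint union and $|{\cal S}_G(\gamma)|=k^{m-n}$ for every $\gamma\in\Gamma_2$, where $${\cal S}_G(\gamma)=\Big\{\gamma\,\mathbf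 g+\sum_{e\in \overline{T}_0}\gamma_e\,\mathbf f_{e}\;:\;\gamma_e\in\Gamma\Big\}.$$
   Context: Graphs are finite and may contain parallel edges and loops. A signed graph is a graph $G$ in which each edge is positive or negative; $E_N$ is the set of negative edges. A circuit is a connected 2-regular graph (a loop is a circuit of length 1); it is unbalanced if it has an odd number of negative edges and balanced otherwise. A signed graph is unbalanced if it contains an unbalanced circuit, and balanced otherwise. A barbell is the union of two unbalanced circuits $C_1,C_2$ and a (possibly trivial) path $P$ with end vertices $v_1\in V(C_1)$, $v_2\in V(C_2)$ such that $C_1-v_1$ is disjoint from $P\cup C_2$ and $C_2-v_2$ is disjoint from $P\cup C_1$; $P$ is its barbell path. A signed circuit is a balanced circuit or a barbell. Orientation: a positive edge is oriented in the usual way (outgoing at one end, incoming at the other). A negative edge consists of two half-edges, one at each end, and is oriented either extroverted (both half-edges point toward the end vertices, so it is incoming at both ends) or introverted (both half-edges point toward the inside of the edge, so it is outgoing at both ends). Given an orientation $D$ of $G$, a $\Gamma$-flow is a map $\mathbf f:E(G)\to\Gamma$ such that at every vertex $v$ the sum of the values of $\mathbf f$ over the edges and half-edges incoming at $v$ equals the sum over those outgoing at $v$ (a loop contributes at $v$ through both of its ends). Flows are viewed as vectors indexed by $E(G)$. $\Gamma_2=\{\gamma\in\Gamma: 2\gamma=0\}$ (zero included). $\epsilon(\Gamma)$ is the largest integer $d$ for which $\Gamma$ has a subgroup isomorphic to $\mathbb Z_2^d$; thus $|\Gamma_2|=2^{\epsilon(\Gamma)}$. Fundamental circuits: for $e\in\overline{T}_0$,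 the graph $T_0+e$ contains a unique signed circuit, denoted $C_e$. Let $\overrightarrow{C}_e$ be the orientation of $C_e$ in which $e$ has the same direction as in $D$ and all other edges are directed consistently with $e$ along $C_e$, i.e. every vertex of $C_e$ has at least one incoming and at least one outgoing (half-)edge of $C_e$. Define the integer vector $\mathbf f_e$ by: $\mathbf f_e(a)=0$ if $a\notin C_e$; for $a\in C_e$, $|\mathbf f_e(a)|=2$ if $C_e$ is a barbell and $a$ lies on its barbell path, and $|\mathbf f_e(a)|=1$ otherwise; and the sign of $\mathbf f_e(a)$ is $+$ if the direction of $a$ in $D$ agrees with that in $\overrightarrow{C}_e$, and $-$ otherwise. Fundamental root circuit: let $C_0$ be the unique circuit of $T_0$ (it contains $e_0$ and is unbalanced). Fix an arbitrary vertex $v$ of $C_0$ and let $\overrightarrow{C}_0$ be the orientation of $C_0$ in which $e_0$ is extroverted, $v$ has in-degree 2 and out-degree 0, and every other vertex of $C_0$ has in-degree 1 and out-degree 1. Define $\mathbf g(a)=1$ if $a\in C_0$ has the same direction in $D$ as in $\overrightarrow{C}_0$, $\mathbf g(a)=-1$ if $a\in C_0$ has the opposite direction, and $\mathbf g(a)=0$ if $a\notin C_0$. *)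

(* Defs.v *)
From HB Require Import structures.
From mathcomp Require Import all_boot all_order all_fingroup all_algebra.

Set Implicit Arguments.
Unset Strict Implicit.
Unset Printing Implicit Defensive.

Import GRing.Theory.

(* The half-edges of an edge [e] are [(e, false)] and [(e, true)]; [ends]
   gives the vertex at which a half-edge sits, so a loop has both half-edges at
   the same vertex and parallel edges are allowed. *)
Record sgraph (V E : finType) := SGraph {
  ends : E * bool -> V;
  neg : {set E}
}.

Section SignedGraph.
Variables (V E : finType) (G : sgraph V E).

(* A subgraph without isolated vertices is represented by its edge set. *)
Implicit Types (F C P T : {set E}) (o D : {ffun E * bool -> bool}).

Definition halfs F (v : V) : {set E * bool} :=
  [set h : E * bool | (h.1 \in F) && (ends G h == v)].

Definition deg F (v : V) : nat := #|halfs F v|.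

Definition vset F : {set V} := [set v | halfs F v != set0].

Definition adj F : rel V := fun u w =>
  [exists h : E * bool,
    [&& h.1 \in F, ends G h == u & ends G (h.1, ~~ h.2) == w]].

Definition connected_graph : bool :=
  [forall u : V, forall w : V, connect (adj [set: E]) u w].

Definition circuit C : bool :=
  [&& C != set0,
      [forall u in vset C, forall w in vset C, connect (adj C) u w] &
      [forall u in vset C, deg C u == 2]].

Definition unbalanced_circuit C : bool := circuit C && odd #|C :&: neg G|.

Definition balanced_circuit C : bool := circuit C && ~~ odd #|C :&: neg G|.

Definition unbalanced_graph : bool :=
  [exists C : {set E}, unbalanced_circuit C].

Definition spanning_tree T : bool :=
  [forall u : V, forall w : V, connect (adj T) u w] &&
  [forall C : {set E}, (C \subset T) ==> ~~ circuit C].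

(* [P] is the edge set of a path with end vertices [x] and [y]; the path is
   trivial (no edge) exactly when [x = y]. *)
Definition is_path P (x y : V) : bool :=
  if x == y then P == set0 else
  [&& [forall u in vset P, forall w in vset P, connect (adj P) u w],
      deg P x == 1, deg P y == 1 &
      [forall u in vset P, (u != x) && (u != y) ==> (deg P u == 2)]].

(* [[set v1; v2] :|: vset P] is the vertex set of the barbell path, also when
   that path is trivial.  The condition [C1 != C2] only excludes taking one
   and the same negative loop twice. *)
Definition barbell_of C1 P C2 : bool :=
  [&& unbalanced_circuit C1, unbalanced_circuit C2, C1 != C2 &
  [exists v1 in vset C1, exists v2 in vset C2,
    [&& is_path P v1 v2,
        [disjoint vset C1 :\ v1 & [set v1; v2] :|: vset P :|: vset C2] &
        [disjoint vset C2 :\ v2 & [set v1; v2] :|: vset P :|: vset C1]]]].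

Definition barbell_with_path C P : bool :=
  [exists C1 : {set E}, exists C2 : {set E},
    barbell_of C1 P C2 && (C == C1 :|: P :|: C2)].

Definition barbell C : bool :=
  [exists P : {set E}, barbell_with_path C P].

Definition signed_circuit C : bool := balanced_circuit C || barbell C.

(* The edge set of the (unique) barbell path of [C]; empty if [C] is not a
   barbell. *)
Definition barbell_path C : {set E} :=
  odflt set0 [pick P : {set E} | barbell_with_path C P].

(* [o h = true] means that the half-edge [h] is incoming at [ends G h].  An
   orientation of a subgraph [F] is only constrained on, and only used through,
   the half-edges of [F]. *)
Definition orientation F o : bool :=
  [forall a in F, (o (a, false) == o (a, true)) == (a \in neg G)].

Definition indeg F o (v : V) : nat := #|[set h in halfs F v | o h]|.

Definition outdeg F o (v : V) : nat := #|[set h in halfs F v | ~~ o h]|.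

Definition same_direction D o (a : E) : bool :=
  [forall b : bool, D (a, b) == o (a, b)].

Definition direction_sign D o (a : E) : int :=
  if same_direction D o a then 1%R else (-1)%R.

(* Fundamental circuits.  The signed circuit of [T0 + e], the circuit of [T0]
   and their prescribed orientations are unique; [pick] selects them, and the
   default values are irrelevant. *)
Definition fund_circuit (T0 : {set E}) (e : E) : {set E} :=
  odflt set0 [pick C : {set E} | signed_circuit C && (C \subset e |: T0)].

Definition fund_orientation D C (e : E) : {ffun E * bool -> bool} :=
  odflt D [pick o : {ffun E * bool -> bool} |
    [&& orientation C o, same_direction D o e &
        [forall v in vset C, (0 < indeg C o v) && (0 < outdeg C o v)]]].

Definition fund_vector D (T0 : {set E}) (e : E) : {ffun E -> int} :=
  let C := fund_circuit T0 e in
  let o := fund_orientation D C e in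
  [ffun a => if a \in C then
               (direction_sign D o a * (if a \in barbell_path C then 2 else 1))%R
             else 0%R].

Definition root_circuit (T0 : {set E}) : {set E} :=
  odflt set0 [pick C : {set E} | circuit C && (C \subset T0)].

Definition root_orientation D C (e0 : E) (v : V) : {ffun E * bool -> bool} :=
  odflt D [pick o : {ffun E * bool -> bool} |
    [&& orientation C o, o (e0, false) && o (e0, true),
        (indeg C o v == 2) && (outdeg C o v == 0) &
        [forall u in vset C :\ v, (indeg C o u == 1) && (outdeg C o u == 1)]]].

Definition root_vector D (T0 : {set E}) (e0 : E) (v : V) : {ffun E -> int} :=
  let C := root_circuit T0 in
  let o := root_orientation D C e0 v in
  [ffun a => if a \in C then direction_sign D o a else 0%R].

Local Open Scope ring_scope.

Definition is_flow (Gam : finZmodType) D (f : {ffun E -> Gam}) : bool :=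
  [forall v : V,
    \sum_(h in halfs [set: E] v | D h) f h.1 ==
    \sum_(h in halfs [set: E] v | ~~ D h) f h.1].

Definition flows (Gam : finZmodType) D : {set {ffun E -> Gam}} :=
  [set f | is_flow D f].

Definition vscale (Gam : finZmodType) (x : Gam) (u : {ffun E -> int}) :
    {ffun E -> Gam} :=
  [ffun a => x *~ u a].

Definition flow_comb (Gam : finZmodType) D (T0 : {set E}) (e0 : E) (v : V)
    (x : Gam) (c : {ffun E -> Gam}) : {ffun E -> Gam} :=
  vscale x (root_vector D T0 e0 v) +
  \sum_(e in ~: T0) vscale (c e) (fund_vector D T0 e).

Definition flow_class (Gam : finZmodType) D (T0 : {set E}) (e0 : E) (v : V)
    (x : Gam) : {set {ffun E -> Gam}} :=
  [set flow_comb D T0 e0 v x c | c : {ffun E -> Gam}].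

End SignedGraph.

Definition Gamma2 (Gam : finZmodType) : {set Gam} :=
  [set x : Gam | (x *+ 2 == 0)%R].

(* The largest [d] such that [Gam] has a subgroup isomorphic to [Z_2^d]; the
   bound [d <= #|Gam|] loses nothing since such a subgroup has [2 ^ d]
   elements. *)
Definition epsilon (Gam : finZmodType) : nat :=
  \max_(d < #|Gam|.+1 |
        [exists H : {group Gam}, H \isog [set: 'rV['Z_2]_d]%G]) d.

(* Main.v *)
Require Import Defs.
From HB Require Import structures.
From mathcomp Require Import all_boot all_order all_fingroup all_algebra.
From mathcomp Require Import zify abelian mxabelem.

(** Every [e] outside [T0] lies on its fundamental circuit, off the barbell
   path, so [f_e] takes the value 1 at [e] and 0 elsewhere outside [T0]; it is
   an integer flow, while [g] is conserved everywhere except at [v], where its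
   boundary is 2.  Hence the coefficients [c e] are the values of the flow
   outside [T0], and [x] is read off at [e0].  Conversely, subtracting
   [f(e) f_e] for all [e] from a flow [f] leaves a flow supported on [T0].
   Positive edges do not contribute to the total boundary, so that the value of
   this flow at [e0] is killed by 2; subtracting the corresponding multiple of
   [g] leaves a flow supported on the forest [T], which is 0.

   The combinatorics rests on one fact: a nonempty edge set with at least as
   many edges as vertices contains a circuit. *)

Set Implicit Arguments.
Unset Strict Implicit.
Unset Printing Implicit Defensive.
Import GRing.Theory Num.Theory.

(** * Edge sets, forests and circuits *)

(** Circuits, barbell paths and orientations enter through [pick], so each must be shown to exist,
    lest a default value be returned; afterwards only the properties guaranteed by the selection are
    used. Orientations are the delicate part, since a circuit is a bare edge set with no cyclic
    order to follow. They come from parities: in a connected edge set, reversing paths makes the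
    in-degree odd at all vertices but one, and at a vertex of degree 2 odd means one in and one out.
    At the exceptional vertex the number of negative edges decides. This is why an unbalanced
    circuit has a sink or a source there, and this is the origin of the weight 2 on barbell paths
    and of the boundary 2 of [g]. Signs relative to [D] are not computed edge by edge: they convert
    a boundary taken in [D] into in- and out-degrees of the prescribed orientation. *)

Section Graphs.
Variables (V E : finType) (G : sgraph V E).
Implicit Types (F C P T : {set E}) (o D : {ffun E * bool -> bool}).

Lemma in_halfs F w h : (h \in halfs G F w) = (h.1 \in F) && (ends G h == w).
Proof. by rewrite inE. Qed.

Lemma ends_vset F h : h.1 \in F -> ends G h \in vset G F.
Proof. by move=> hF; rewrite inE; apply/set0Pn; exists h; rewrite in_halfs hF eqxx. Qed.

Lemma vsetP F w : reflect (exists2 h, h.1 \in F & ends G h = w) (w \in vset G F).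
Proof.
rewrite in_set; apply: (iffP (set0Pn _)) => [[h]|[h hF hw]].
  by rewrite in_halfs => /andP[hF /eqP hw]; exists h.
by exists h; rewrite in_halfs hF hw eqxx.
Qed.

Lemma deg_gt0 F w : (0 < deg G F w) = (w \in vset G F).
Proof. by rewrite /deg inE card_gt0. Qed.

Lemma deg_eq0 F w : w \notin vset G F -> deg G F w = 0.
Proof. by rewrite -deg_gt0 -eqn0Ngt => /eqP. Qed.

Lemma subset_vset F F' : F \subset F' -> vset G F \subset vset G F'.
Proof.
by move=> sF; apply/subsetP => w /vsetP[h hF <-]; apply/ends_vset/(subsetP sF).
Qed.

Lemma vsetU F F' : vset G (F :|: F') = vset G F :|: vset G F'.
Proof.
apply/setP => w; rewrite in_setU; apply/vsetP/orP => [[h]|].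
  by rewrite inE => /orP[hF|hF] <-; [left|right]; apply: ends_vset.
by case=> /vsetP[h hF <-]; exists h; rewrite // inE hF ?orbT.
Qed.

Lemma halfsU F F' w : halfs G (F :|: F') w = halfs G F w :|: halfs G F' w.
Proof. by apply/setP => h; rewrite !inE andb_orl. Qed.

Lemma halfs_disjoint F F' w :
  [disjoint F & F'] -> [disjoint halfs G F w & halfs G F' w].
Proof.
move=> dF; rewrite disjoint_subset; apply/subsetP => h.
rewrite !inE => /andP[hF ->]; rewrite andbT.
by rewrite (disjointFr dF hF).
Qed.

Lemma degUI F F' w :
  deg G (F :|: F') w + deg G (F :&: F') w = deg G F w + deg G F' w.
Proof.
rewrite /deg -(cardsUI (halfs G F w)) -halfsU; congr (_ + _); apply: eq_card => h.
by rewrite in_setI !in_halfs in_setI; case: (h.1 \in F); case: (h.1 \in F'); case: (_ == w).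
Qed.

(** Double counting over any commutative monoid, so that one statement serves degree sums, parities
    of in-degrees and total boundaries. *)
Lemma big_halfs (M : nmodType) F (phi : E * bool -> M) :
  (\sum_w \sum_(h in halfs G F w) phi h =
   \sum_(a in F) (phi (a, false) + phi (a, true)))%R.
Proof.
have -> : (\sum_(a in F) (phi (a, false) + phi (a, true)) =
           \sum_(h : E * bool | h.1 \in F) phi h)%R.
  rewrite (eq_bigr (fun a => \sum_(b : bool) phi (a, b))%R) => [|a _]; last first.
    by rewrite big_bool addrC.
  by rewrite pair_big_dep /=; apply: eq_big => [[a b]|[a b] _] //=; rewrite andbT.
rewrite (partition_big (ends G) predT) //=.
by apply: eq_bigr => w _; apply: eq_bigl => h; rewrite in_halfs.
Qed.

Lemma sum_deg F : \sum_w deg G F w = #|F|.*2.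
Proof.
transitivity (\sum_w \sum_(h in halfs G F w) 1).
  by apply: eq_bigr => w _; rewrite sum1_card.
apply: etrans (big_halfs F (fun=> 1%N)) _.
by apply: etrans (sum_nat_const _ _) _; rewrite muln2.
Qed.

Lemma connect_adj_ind F (A : V -> Prop) x y :
    (forall h, h.1 \in F -> A (ends G h) -> A (ends G (h.1, ~~ h.2))) ->
  connect (adj G F) x y -> A x -> A y.
Proof.
move=> step /connectP[p + ->]; elim: p x => //= z p IH x /andP[/existsP[h]].
by case/and3P=> hF /eqP<- /eqP<- /IH{}IH /(step h hF)/IH.
Qed.

Lemma adj_ends F h : h.1 \in F -> adj G F (ends G h) (ends G (h.1, ~~ h.2)).
Proof. by move=> hF; apply/existsP; exists h; rewrite hF !eqxx. Qed.

Lemma adj_sym F : symmetric (adj G F).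
Proof.
suff sub x y : adj G F x y -> adj G F y x by move=> x y; apply/idP/idP; apply: sub.
case/existsP=> -[a b] /and3P[/= hF hx hy]; apply/existsP; exists (a, ~~ b).
by rewrite hF hy negbK hx.
Qed.

Lemma connect_adj_sym F x y : connect (adj G F) x y = connect (adj G F) y x.
Proof. by apply: sym_connect_sym; apply: adj_sym. Qed.

Lemma connect_vset F x y :
  connect (adj G F) x y -> x \in vset G F -> y \in vset G F.
Proof.
apply: (connect_adj_ind (A := fun z => z \in vset G F)) => h hF _.
exact: (@ends_vset F (h.1, ~~ h.2) hF).
Qed.

(* A vertex subset [A] of [W] is determined by whether it contains [r] and by
   the edges that it cuts, so [2 ^ #|W| <= 2 * 2 ^ #|F|]. *)
Lemma connected_card F (W : {set V}) r :
  {in W, forall w, connect (adj G F) r w} -> #|W| <= #|F|.+1.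
Proof.
move=> conW.
pose cut (A : {set V}) := [set a in F | (ends G (a, false) \in A) != (ends G (a, true) \in A)].
pose code (A : {set V}) := (r \in A, cut A).
have inj : {in powerset W &, injective code}.
  move=> A B; rewrite !powersetE => sA sB [hr hc]; apply/setP => w.
  have sameF y : connect (adj G F) r y -> (y \in A) = (y \in B).
    move=> ry; apply: (connect_adj_ind (A := fun z => (z \in A) = (z \in B))) ry hr.
    move=> [a b] /= aF; move/setP/(_ a): hc; rewrite !inE aF /=.
    by case: b; do 4![case: (_ \in _)].
  have [wW|wW] := boolP (w \in W); first exact/sameF/conW.
  by rewrite (contraNF (subsetP sA w) wW) (contraNF (subsetP sB w) wW).
have sub : code @: powerset W \subset setX [set: bool] (powerset F).
  apply/subsetP => _ /imsetP[A _ ->]; rewrite !inE /=.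
  by apply/subsetP => a; rewrite inE => /andP[].
have := subset_leq_card sub; rewrite (card_in_imset inj) cardsX cardsT card_bool.
by rewrite !card_powerset -expnS leq_exp2l.
Qed.

Lemma circuitP C : reflect
  [/\ C != set0, {in vset G C &, forall u w, connect (adj G C) u w} &
      {in vset G C, forall u, deg G C u = 2}] (circuit G C).
Proof.
apply: (iffP and3P) => -[C0 conC degC]; split=> //.
- by move=> u w hu hw; exact: (forall_inP (forall_inP conC u hu)).
- by move=> u hu; exact/eqP/(forall_inP degC).
- by apply/forall_inP => u hu; apply/forall_inP => w hw; apply: conC.
- by apply/forall_inP => u hu; apply/eqP/degC.
Qed.

Lemma deg_circuit C w : circuit G C -> deg G C w = (w \in vset G C).*2.
Proof.
by case/circuitP => _ _ dC; case: (boolP (w \in _)) => [/dC //|/deg_eq0].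
Qed.

Lemma circuit_card C : circuit G C -> #|vset G C| = #|C|.
Proof.
move=> cC; apply: double_inj; rewrite -sum_deg -sum1_card.
rewrite -muln2 big_distrl /= big_mkcond; apply: eq_bigr => w _.
by rewrite deg_circuit //; case: ifP.
Qed.

Lemma sum_deg_vset F : \sum_(w in vset G F) deg G F w = #|F|.*2.
Proof.
rewrite -sum_deg [RHS](bigID (mem (vset G F))) /= [X in _ = _ + X]big1 ?addn0 //.
by move=> w; exact: deg_eq0.
Qed.

(* An edge set that is minimal for this property is a circuit: it has as many
   edges as vertices, no vertex of degree 1, and a component that is as dense. *)
Lemma dense_circuit F :
  F != set0 -> #|vset G F| <= #|F| -> exists2 C : {set E}, C \subset F & circuit G C.
Proof.
move=> F0 dF; pose p := fun C : {set E} => (C != set0) && (#|vset G C| <= #|C|).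
have [|C /minsetP[/andP[C0 dC] minC] sCF] := @minset_exists _ p F.
  by rewrite /p F0.
exists C => //.
have cardD a : a \in C -> #|C| = #|C :\ a|.+1 by move=> aC; rewrite (cardsD1 a) aC.
have sparse (F' : {set E}) : F' \proper C -> F' != set0 -> #|F'| < #|vset G F'|.
  move=> /properP[sF' [a aC aF']] nF'; rewrite ltnNge; apply/negP => dF'.
  by move: aF'; rewrite (minC F') ?aC // /p nF'.
(* By minimality, deleting one edge leaves fewer edges than vertices; putting it back gives at most
   as many edges as vertices. *)
have eqC : #|vset G C| = #|C|.
  have [a aC] := set0Pn _ C0; apply/eqP; rewrite eqn_leq dC /= (cardD a aC).
  have [->|nD] := eqVneq (C :\ a) set0.
    by rewrite cards0 card_gt0; apply/set0Pn; exists (ends G (a, true)); apply: ends_vset.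
  apply: leq_trans (sparse _ (properD1 aC) nD) _.
  by apply/subset_leq_card/subset_vset/subD1set.
(* Without the edge [a] at [u], sparsity forces the vertex set to stay the same, so another edge
   still meets [u]. If [a] is the only edge, there is a single vertex and [a] is a loop. *)
have deg2 u : u \in vset G C -> 2 <= deg G C u.
  move=> uC; have /vsetP[[a b] aC eu] := uC; rewrite /= in aC.
  have [nD|nD] := eqVneq (C :\ a) set0.
    have eC : C = [set a] by rewrite -(setD1K aC) nD setU0.
    have c1 : #|vset G C| = 1 by rewrite eqC eC cards1.
    have := sum_deg_vset C; have /eqP/cards1P[z ez] := c1.
    move: uC; rewrite ez inE => /eqP->; rewrite big_set1 => ->.
    by rewrite eC cards1.
  have := sparse _ (properD1 aC) nD; rewrite -ltnS -cardD // -eqC ltnS => le.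
  have /eqP eV : vset G (C :\ a) == vset G C.
    by rewrite eqEcard le subset_vset ?subD1set.
  move: uC; rewrite -eV => /vsetP[h]; rewrite !inE => /andP[ha hC] hu.
  rewrite /deg (cardsD1 (a, b)) in_halfs aC eu eqxx ltnS card_gt0.
  apply/set0Pn; exists h; rewrite !inE hC hu eqxx !andbT.
  by apply: contraNneq ha => ->.
have degC : {in vset G C, forall u, deg G C u = 2}.
  have := sum_deg_vset C; rewrite -eqC -muln2 -sum_nat_const => /esym/eqP.
  by rewrite (leqif_sum (fun u uC => leqif_eq (deg2 u uC))) => /forall_inP H u /H/eqP.
apply/circuitP; split=> // u w uC wC.
(* [K] is the component of [u]. If it were proper, [K] and its complement would be vertex-disjoint
   and both have fewer edges than vertices, against [eqC]. *)
pose K := [set a in C | connect (adj G C) u (ends G (a, true))].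
have inK h : h.1 \in C -> (h.1 \in K) = connect (adj G C) u (ends G h).
  case: h => a [] /= aC; rewrite inE aC //=.
  by apply/idP/idP => H; apply: connect_trans H (connect1 _);
    [exact: (@adj_ends C (a, true)) | exact: (@adj_ends C (a, false))].
have sK : K \subset C by apply/subsetP => a; rewrite inE => /andP[].
have [/eqP eK|nK] := boolP (K == C).
  by have /vsetP[h hC <-] := wC; rewrite -inK // eK.
have pK : K \proper C by rewrite properEneq nK.
have K0 : K != set0.
  have /vsetP[h hC hu] := uC; apply/set0Pn; exists h.1; rewrite inK // hu.
  exact: connect0.
have pD : C :\: K \proper C.
  have [a aK] := set0Pn _ K0; apply/properP; split; first exact: subsetDl.
  by exists a; rewrite ?(subsetP sK) // inE aK.
have D0 : C :\: K != set0 by move: pK; rewrite setD_eq0 properE => /andP[].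
have disj : vset G K :&: vset G (C :\: K) = set0.
  apply/setP => x; rewrite in_setI in_set0; apply/negP => /andP[/vsetP[h hK <-]].
  case/vsetP => h' /setDP[h'C /negP h'K] eh; apply: h'K.
  by rewrite inK // eh -inK // (subsetP sK).
have := leq_add (sparse _ pK K0) (sparse _ pD D0).
rewrite -cardsUI disj cards0 addn0 -vsetU setUC.
have -> : C :\: K :|: K = C by rewrite setUC -{1}(setIidPr sK) setID.
rewrite eqC; have := cardsID K C; rewrite (setIidPr sK) => <-.
by move: #|K| #|C :\: K|; clear => p q; lia.
Qed.

(** * Forests, symmetric differences and spanning trees *)

Definition forest F := forall C, C \subset F -> ~~ circuit G C.

Lemma forestS F F' : F' \subset F -> forest F -> forest F'.
Proof. by move=> sF forF C sC; apply: forF; apply: subset_trans sF. Qed.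

Lemma forest_card F : forest F -> F != set0 -> #|F| < #|vset G F|.
Proof.
move=> forF F0; rewrite ltnNge; apply/negP => /(dense_circuit F0)[C sC].
exact/negP/forF.
Qed.

Lemma deg_ge2_circuit F : F != set0 -> {in vset G F, forall w, 1 < deg G F w} ->
  exists2 C : {set E}, C \subset F & circuit G C.
Proof.
move=> F0 dF; apply: dense_circuit => //; rewrite -leq_double -sum_deg_vset.
by rewrite -muln2 -sum_nat_const; apply: leq_sum.
Qed.

Lemma even_circuit F : F != set0 -> (forall w, ~~ odd (deg G F w)) ->
  exists2 C : {set E}, C \subset F & circuit G C.
Proof.
move=> F0 evF; apply: deg_ge2_circuit => // w; rewrite -deg_gt0.
by have := evF w; case: (deg G F w) => [|[]].
Qed.

Definition symdiff F F' := (F :\: F') :|: (F' :\: F).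

Lemma odd_deg_symdiff F F' w :
  odd (deg G (symdiff F F') w) = odd (deg G F w) (+) odd (deg G F' w).
Proof.
have degD A B : deg G A w = deg G (A :\: B) w + deg G (A :&: B) w.
  have := degUI (A :\: B) (A :&: B) w.
  rewrite setUC setID => <-; rewrite [X in _ + X]deg_eq0 ?addn0 //.
  by apply/vsetP => -[h]; rewrite !inE; do 2!case: (_ \in _).
have := degUI (F :\: F') (F' :\: F) w; rewrite [X in _ + X]deg_eq0; last first.
  by apply/vsetP => -[h]; rewrite !inE; do 2!case: (_ \in _).
rewrite (degD F F') (degD F' F) addn0 /symdiff (setIC F') => ->.
by rewrite !oddD; do 3!case: (odd _).
Qed.

(** All degrees of a circuit are even, hence so are those of the nonempty symmetric difference. *)
Lemma circuits_symdiff C C' : circuit G C -> circuit G C' -> C != C' ->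
  exists2 B : {set E}, B \subset symdiff C C' & circuit G B.
Proof.
move=> cC cC' neC; apply: even_circuit => [|w].
  by apply: contra neC; rewrite setU_eq0 !setD_eq0 -eqEsubset.
by rewrite odd_deg_symdiff !deg_circuit // !odd_double.
Qed.

Lemma forest_circuit_mem T e C : forest T -> circuit G C -> C \subset e |: T -> e \in C.
Proof.
move=> forT cC sC; apply: contraLR (cC) => eC; apply: forT; apply/subsetP => a aC.
by have := subsetP sC a aC; rewrite in_setU1; case: eqP aC eC => // -> ->.
Qed.

(** Both circuits pass through [e], which therefore cancels in the symmetric difference; a circuit
    found there would lie in the forest. *)
Lemma unicyclic T e C C' : forest T ->
  circuit G C -> C \subset e |: T -> circuit G C' -> C' \subset e |: T -> C = C'.
Proof.
move=> forT cC sC cC' sC'; have [//|neC] := eqVneq C C'.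
have [B sB cB] := circuits_symdiff cC cC' neC.
suff sBT : B \subset T by case: (negP (forT B sBT)).
apply: (subset_trans sB); apply/subsetP => a.
have eC := forest_circuit_mem forT cC sC.
have eC' := forest_circuit_mem forT cC' sC'.
rewrite !inE => /orP[]/andP[nC aC].
  by have := subsetP sC a aC; rewrite in_setU1; case: eqP nC => // ->; rewrite eC'.
by have := subsetP sC' a aC; rewrite in_setU1; case: eqP nC => // ->; rewrite eC.
Qed.

Lemma spanning_treeP T : reflect
  ((forall u w, connect (adj G T) u w) /\ forest T) (spanning_tree G T).
Proof.
apply: (iffP andP) => -[conT forT]; split.
- by move=> u w; exact: (forallP (forallP conT u) w).
- by move=> C sC; exact: (implyP (forallP forT C) sC).
- by apply/forallP => u; apply/forallP => w; apply: conT.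
- by apply/forallP => C; apply/implyP; apply: forT.
Qed.

(** Connectedness bounds the number of vertices from above, acyclicity from below; [r] excludes the
    empty vertex set, for which the equation fails. *)
Lemma spanning_tree_card T (r : V) : spanning_tree G T -> #|T|.+1 = #|V|.
Proof.
case/spanning_treeP => conT forT; apply/eqP; rewrite eqn_leq -{2}cardsT.
rewrite (connected_card (F := T) (r := r)) => [|w _]; last exact: conT.
rewrite andbT; have [->|T0] := eqVneq T set0.
  by rewrite cards0; apply/card_gt0P; exists r.
exact: leq_trans (forest_card forT T0) (max_card _).
Qed.

(* [o'] reverses the edges of a path from [x] to [y]. *)
Lemma flip_path F o x y : connect (adj G F) x y -> orientation G F o ->
  exists2 o', orientation G F o' & forall w,
    odd (indeg G F o' w) = odd (indeg G F o w) (+) (w == x) (+) (w == y).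
Proof.
move=> cxy oro; apply: (connect_adj_ind (F := F) (A := fun z =>
  exists2 o', orientation G F o' & forall w,
    odd (indeg G F o' w) = odd (indeg G F o w) (+) (w == x) (+) (w == z))) cxy _; last first.
  by exists o => // w; rewrite -addbA addbb addbF.
move=> h hF [o1 or1 H1].
pose o2 : {ffun E * bool -> bool} := [ffun k : E * bool => o1 k (+) (k.1 == h.1)].
exists o2.
  apply/forall_inP => a aF; rewrite !ffunE /= -(eqP (forall_inP or1 a aF)).
  by case: (a == h.1); case: (o1 _); case: (o1 _).
(* As an xor over half-edges, the parity changes under reversal of an edge by the xor of an
   indicator, which splits off. *)
have odd_indeg o' w :
    odd (indeg G F o' w) = \big[addb/false]_(k in halfs G F w) o' k.
  rewrite /indeg -sum1_card (big_morph odd oddD (erefl (odd 0))).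
  rewrite (eq_bigl (fun k => (k \in halfs G F w) && o' k)); last by move=> k; rewrite inE.
  by rewrite big_mkcondr /=; apply: eq_bigr => k _; case: (o' k).
move=> w; rewrite odd_indeg.
under eq_bigr do rewrite ffunE.
rewrite big_split /= -odd_indeg H1.
have -> : \big[addb/false]_(k in halfs G F w) (k.1 == h.1) =
   (w == ends G h) (+) (w == ends G (h.1, ~~ h.2)).
  rewrite big_mkcond (bigD1 h) // (bigD1 (h.1, ~~ h.2)) /=; last first.
    by case: (h) => a []; rewrite xpair_eqE eqxx.
  rewrite !in_halfs /= hF eqxx !(eq_sym w) big1 ?addbF => [|k /andP[]].
    by do 2![case: (_ == w)].
  case: h {hF H1 o2} => a b; case: k => a' b'; rewrite !xpair_eqE /=.
  by case: (a' == a); case: b; case: b'; case: (_ \in _).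
by case: (w == x); case: (w == ends G h); case: (w == ends G _); case: (odd _).
Qed.

(** Reversing a path from a vertex of even in-degree to [s] repairs that vertex and changes no other
    parity except at [s], so the number of bad vertices drops. *)
Lemma orientation_exists F s : {in vset G F, forall w, connect (adj G F) w s} ->
  exists2 o, orientation G F o & {in vset G F, forall w, w != s -> odd (indeg G F o w)}.
Proof.
move=> conF.
pose o0 : {ffun E * bool -> bool} := [ffun k => k.2 || (k.1 \in neg G)].
have or0 : orientation G F o0.
  by apply/forall_inP => a _; rewrite !ffunE /=; case: (a \in _).
pose bad (o : {ffun E * bool -> bool}) := [set w in vset G F :\ s | ~~ odd (indeg G F o w)].
have [k] := ubnP #|bad o0|; elim: k o0 or0 => // k IH o oro; rewrite ltnS => le.
have [e0|[w]] := set_0Vmem (bad o).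
  exists o => // w wF ws; move/setP/(_ w): e0; rewrite !inE ws.
  by rewrite inE in wF; rewrite wF /= => /negbFE.
rewrite in_set in_setD1 => /andP[/andP[ws wF] nw].
have [o' or' H] := flip_path (conF w wF) oro.
apply: IH or' _; apply: leq_trans le; apply/proper_card/properP; split.
  apply/subsetP => u; rewrite ![u \in bad _]in_set in_setD1 H => /andP[/andP[us ->]].
  by rewrite us (negPf us) addbF /=; case: eqP => [->|]; rewrite ?addbF ?addbT //= (negPf nw).
exists w; first by rewrite in_set in_setD1 ws wF nw.
by rewrite in_set in_setD1 ws wF H eqxx (negPf ws) (negPf nw).
Qed.
End Graphs.

(** * Orientations of circuits and barbells *)

Section Orientations.
Variables (V E : finType) (G : sgraph V E).
Implicit Types (F C P T : {set E}) (o D : {ffun E * bool -> bool}).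

Lemma inoutdeg F o w : indeg G F o w + outdeg G F o w = deg G F w.
Proof.
rewrite /deg -(cardsID [set h | o h] (halfs G F w)); congr (_ + _).
  by apply: eq_card => h; rewrite !inE.
by apply: eq_card => h; rewrite !inE andbC.
Qed.

Lemma eq_indeg F o o' w :
  {in F, forall a b, o (a, b) = o' (a, b)} -> indeg G F o w = indeg G F o' w.
Proof.
move=> eqo; apply: eq_card => -[a b]; rewrite !inE /=.
by case: (boolP (a \in F)) => //= aF; rewrite eqo.
Qed.

Lemma eq_outdeg F o o' w :
  {in F, forall a b, o (a, b) = o' (a, b)} -> outdeg G F o w = outdeg G F o' w.
Proof.
by move=> eqo; apply: (@addnI (indeg G F o w)); rewrite {2}(eq_indeg _ eqo) !inoutdeg.
Qed.

Lemma indegU F F' o w : [disjoint F & F'] ->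
  indeg G (F :|: F') o w = indeg G F o w + indeg G F' o w.
Proof.
move=> dF; rewrite /indeg -cardsUI -[LHS]addn0; congr (_ + _).
  by apply: eq_card => h; rewrite !inE andb_orl andb_orl.
apply/esym/eqP; rewrite cards_eq0; apply/eqP/setP => h; rewrite !inE.
by case: (boolP (h.1 \in F)) => //= hF; rewrite (disjointFr dF hF) /= !andbF.
Qed.

Lemma outdegU F F' o w : [disjoint F & F'] ->
  outdeg G (F :|: F') o w = outdeg G F o w + outdeg G F' o w.
Proof.
move=> dF; apply: (@addnI (indeg G (F :|: F') o w)); rewrite inoutdeg indegU //.
rewrite addnACA !inoutdeg -degUI; move: dF; rewrite -setI_eq0 => /eqP->.
by rewrite [X in _ + X]deg_eq0 ?addn0 //; apply/vsetP => -[h]; rewrite inE.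
Qed.

Lemma orientationS F F' o :
  F \subset F' -> orientation G F' o -> orientation G F o.
Proof.
by move=> /subsetP sF /forall_inP oro; apply/forall_inP => a /sF/oro.
Qed.

Definition flip o : {ffun E * bool -> bool} := [ffun h => ~~ o h].

Lemma flip_orientation F o : orientation G F o -> orientation G F (flip o).
Proof.
move=> /forall_inP oro; apply/forall_inP => a aF; rewrite !ffunE -(eqP (oro a aF)).
by case: (o _); case: (o _).
Qed.

Lemma indeg_flip F o w : indeg G F (flip o) w = outdeg G F o w.
Proof. by apply: eq_card => h; rewrite !inE ffunE. Qed.

Lemma outdeg_flip F o w : outdeg G F (flip o) w = indeg G F o w.
Proof. by apply: eq_card => h; rewrite !inE ffunE negbK. Qed.

(** A positive edge is incoming at one end, a negative edge at none or at both; only the positive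
    edges count modulo 2. *)
Lemma odd_sum_indeg F o : orientation G F o ->
  odd (\sum_w indeg G F o w) = odd #|F| (+) odd #|F :&: neg G|.
Proof.
move=> oro.
have -> : \sum_w indeg G F o w = \sum_(a in F) (o (a, false) + o (a, true)).
  transitivity (\sum_w \sum_(h in halfs G F w) (o h : nat)); last first.
    exact: etrans (big_halfs G F (fun h => nat_of_bool (o h))) _.
  apply: eq_bigr => w _; rewrite -big_mkcondr /= sum1_card.
  by apply: eq_card => h; rewrite in_set.
rewrite -(cardsID (neg G) F) oddD addbAC addbb /= -sum1_card.
rewrite !(big_morph odd oddD (erefl (odd 0))).
rewrite [RHS](eq_bigl (fun a => (a \in F) && (a \notin neg G))) => [|a]; last first.
  by rewrite inE andbC.
rewrite [RHS]big_mkcondr; apply: eq_bigr => a aF; rewrite -(eqP (forall_inP oro a aF)).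
by case: (o _); case: (o _).
Qed.

(** The total in-degree has the parity of the number of positive edges, and the other [#|C| - 1]
    vertices contribute 1 each modulo 2, which forces the parity at [s]. *)
Lemma circuit_parity C o s : circuit G C -> orientation G C o ->
    s \in vset G C -> {in vset G C, forall w, w != s -> odd (indeg G C o w)} ->
  odd (indeg G C o s) = ~~ odd #|C :&: neg G|.
Proof.
move=> cC oro sC oddC; have := odd_sum_indeg oro.
rewrite (bigID (mem (vset G C))) /= [X in odd (_ + X)]big1 => [|w wC]; last first.
  by apply/eqP; have := inoutdeg C o w; rewrite deg_eq0 //; lia.
rewrite addn0 (bigD1 s) //= oddD.
have -> : odd (\sum_(w in vset G C | w != s) indeg G C o w) = odd #|vset G C :\ s|.
  rewrite -sum1_card !(big_morph odd oddD (erefl (odd 0))).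
  rewrite [RHS](eq_bigl (fun w => (w \in vset G C) && (w != s))) => [|w].
    by apply: eq_bigr => w /andP[wC ws]; rewrite oddC.
  by rewrite in_setD1 andbC.
rewrite -(circuit_card cC) (cardsD1 s (vset G C)) sC /=.
by case: (odd _); case: (odd _); case: (odd _).
Qed.

(** Both orientations obey the sign constraint on [e], so they agree on both of its half-edges or on
    neither. *)
Lemma flip_same_direction D o F e :
    orientation G [set: E] D -> orientation G F o -> e \in F ->
  same_direction D o e || same_direction D (flip o) e.
Proof.
move=> /forall_inP/(_ e (in_setT _))/eqP orD /forall_inP oro eF.
move/(_ e eF)/eqP: oro orD => <- orD.
have {}orD : (D (e, false) (+) o (e, false)) = (D (e, true) (+) o (e, true)).
  by move: orD; do 2!case: (D _); do 2!case: (o _).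
have [D0|D0] := boolP (D (e, false) == o (e, false)); apply/orP; [left|right];
  apply/forallP => -[]; rewrite ?ffunE //; move: D0 orD; do 2!case: (D _); do 2!case: (o _) => //.
Qed.

Lemma sameN_direction D o F a :
    orientation G [set: E] D -> orientation G F o -> a \in F ->
    ~~ same_direction D o a -> forall b, D (a, b) = ~~ o (a, b).
Proof.
move=> orD oro aF nsame b; have := flip_same_direction orD oro aF.
by rewrite (negPf nsame) => /forallP/(_ b)/eqP ->; rewrite ffunE.
Qed.

(** In the unbalanced case [s] is a source or a sink, and reversing every edge exchanges the two;
    [b] asks for a sink. *)
Lemma orient_circuit C s (b : bool) : circuit G C -> s \in vset G C ->
  exists2 o, orientation G C o &
    {in vset G C, forall w, w != s -> indeg G C o w = 1 /\ outdeg G C o w = 1} /\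
    (if odd #|C :&: neg G| then
       indeg G C o s = b.*2 /\ outdeg G C o s = (~~ b).*2
     else indeg G C o s = 1 /\ outdeg G C o s = 1).
Proof.
move=> cC sC; have [_ conC degC] := circuitP _ _ cC.
have [w wC|o oro oddo] := @orientation_exists _ _ G C s; first exact: conC.
have io w : w \in vset G C -> indeg G C o w + outdeg G C o w = 2.
  by move=> wC; rewrite inoutdeg degC.
have io1 : {in vset G C, forall w, w != s -> indeg G C o w = 1 /\ outdeg G C o w = 1}.
  by move=> w wC ws; have := oddo w wC ws; have := io w wC; lia.
have := circuit_parity cC oro sC oddo; have := io s sC.
case: (odd #|_|) => /= ios par; last by exists o => //; split=> //; lia.
have [eb|neb] := eqVneq (indeg G C o s) b.*2.
  by exists o => //; split=> //; move: ios par eb; case: (b) => /=; lia.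
exists (flip o); first exact: flip_orientation.
split; last by rewrite indeg_flip outdeg_flip; move: ios par neb; case: (b) => /=; lia.
by move=> w wC ws; rewrite indeg_flip outdeg_flip; have [] := io1 w wC ws.
Qed.

(** The separation conditions in pointwise form, with the edge-disjointness that follows from them,
    so that degrees and sums add up over the three parts. *)
Record barbell_at (C1 P C2 : {set E}) (v1 v2 : V) : Prop := BarbellAt {
  bb_circ1 : unbalanced_circuit G C1;
  bb_circ2 : unbalanced_circuit G C2;
  bb_v1 : v1 \in vset G C1;
  bb_v2 : v2 \in vset G C2;
  bb_path : is_path G P v1 v2;
  bb_sep1 : {in vset G C1, forall w, w != v1 -> w \notin vset G P :|: vset G C2};
  bb_sep2 : {in vset G C2, forall w, w != v2 -> w \notin vset G P :|: vset G C1};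
  bb_ne : v1 != v2 -> (v1 \notin vset G C2) /\ (v2 \notin vset G C1);
  bb_dis1 : [disjoint C1 & P];
  bb_dis2 : [disjoint C2 & P];
  bb_dis12 : [disjoint C1 & C2] }.

(** A loop uses up both half-edges that a circuit has at [w], so connectivity reaches no other
    edge. *)
Lemma loop_circuit C a w : circuit G C -> a \in C ->
  (forall b, ends G (a, b) = w) -> C = [set a].
Proof.
move=> cC aC loop; have [_ conC degC] := circuitP _ _ cC.
have aw b : (a, b) \in halfs G C w by rewrite in_halfs aC loop eqxx.
have wC : w \in vset G C by rewrite -(loop true) ends_vset.
have hw : halfs G C w = [set (a, false); (a, true)].
  apply/esym/eqP; rewrite eqEcard; apply/andP; split.
    by apply/subsetP => h; rewrite !inE => /orP[]/eqP->; have:= aw false; have := aw true;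
      rewrite !in_halfs.
  by rewrite (degC w wC : #|_| = 2) cards2 xpair_eqE andbF.
have at_w h : h.1 \in C -> ends G h = w -> h.1 = a.
  move=> hC hh; have : h \in halfs G C w by rewrite in_halfs hC hh eqxx.
  by rewrite hw !inE => /orP[]/eqP->.
apply/eqP; rewrite eqEsubset sub1set aC andbT; apply/subsetP => c cC'.
rewrite inE; apply/eqP/(at_w (c, true)) => //.
have := conC w _ wC (ends_vset G (cC' : (c, true).1 \in C)).
move/(connect_adj_ind (A := fun z => z = w)); apply=> // h hC hh.
by rewrite (at_w h).
Qed.

Lemma path_ends P x y : is_path G P x y -> x != y ->
  deg G P x = 1 /\ deg G P y = 1.
Proof. by rewrite /is_path => + /negPf nxy; rewrite nxy => /and4P[_ /eqP-> /eqP->]. Qed.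

Lemma path_inner P x y w : is_path G P x y -> w != x -> w != y ->
  deg G P w = (w \in vset G P).*2.
Proof.
move=> pP wx wy; case: (boolP (w \in _)) => [wP|/deg_eq0 //].
move: pP; rewrite /is_path; case: eqP => [_ /eqP P0|_].
  by move: wP; rewrite P0 => /vsetP[h]; rewrite inE.
by case/and4P => _ _ _ /forall_inP/(_ w wP); rewrite wx wy => /eqP.
Qed.

Lemma deg_loop F a w : a \in F -> (forall b, ends G (a, b) = w) -> 1 < deg G F w.
Proof.
move=> aF loop; have := subset_leq_card (_ : [set (a, false); (a, true)] \subset halfs G F w).
rewrite cards2 xpair_eqE andbF; apply.
by apply/subsetP => h; rewrite in_halfs !inE => /orP[]/eqP-> /=; rewrite aF loop eqxx.
Qed.

Lemma barbell_ofP C1 P C2 : barbell_of G C1 P C2 ->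
  exists v1 v2, barbell_at C1 P C2 v1 v2.
Proof.
case/and4P => uC1 uC2 neC /exists_inP[v1 v1C /exists_inP[v2 v2C]].
case/and3P => pP dis1 dis2; exists v1, v2.
have [[cC1 _] [cC2 _]] := (andP uC1, andP uC2).
have sep1 w : w \in vset G C1 -> w != v1 -> w \notin [set v1; v2] :|: vset G P :|: vset G C2.
  by move=> wC wv; rewrite (disjointFr dis1) // in_setD1 wv.
have sep2 w : w \in vset G C2 -> w != v2 -> w \notin [set v1; v2] :|: vset G P :|: vset G C1.
  by move=> wC wv; rewrite (disjointFr dis2) // in_setD1 wv.
(* A common edge of [C] and [P] would be a loop at [v], giving an end of the path degree at least
   2. *)
have disP C v : circuit G C -> v \in [set v1; v2] ->
    {in vset G C, forall w, w != v -> w \notin vset G P} -> [disjoint C & P].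
  move=> cC vin sep; rewrite disjoint_subset; apply/subsetP => a aC.
  rewrite inE; apply/negP => aP.
  have av b : ends G (a, b) = v.
    apply/eqP; apply: contraT => /(sep _ (ends_vset G (aC : (a, b).1 \in C))).
    by rewrite (ends_vset G (aP : (a, b).1 \in P)).
  have := deg_loop aP av; have [e12|n12] := eqVneq v1 v2.
    by move: pP aP; rewrite /is_path e12 eqxx => /eqP->; rewrite inE.
  have [d1 d2] := path_ends pP n12.
  by move: vin; rewrite !inE => /orP[]/eqP->; rewrite ?d1 ?d2.
split=> //.
- by move=> w wC wv; apply: contra (sep1 w wC wv); rewrite -setUA in_setU orbC => ->.
- by move=> w wC wv; apply: contra (sep2 w wC wv); rewrite -setUA in_setU orbC => ->.
- move=> n12; split.
    by apply/negP => H; have := sep2 v1 H n12; rewrite !in_setU !inE eqxx.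
  by apply/negP => H; rewrite eq_sym in n12; have := sep1 v2 H n12; rewrite !in_setU !inE eqxx orbT.
- apply: (disP _ v1) => //; first by rewrite !inE eqxx.
  by move=> w wC wv; apply: contra (sep1 w wC wv); rewrite !in_setU => ->; rewrite orbT.
- apply: (disP _ v2) => //; first by rewrite !inE eqxx orbT.
  by move=> w wC wv; apply: contra (sep2 w wC wv); rewrite !in_setU => ->; rewrite orbT.
(* A common edge has both ends at [v1], so it is a loop and makes up both circuits, contrary to
   [C1 != C2]. *)
rewrite disjoint_subset; apply/subsetP => a aC1; rewrite inE; apply/negP => aC2.
have a1 b : ends G (a, b) = v1.
  apply/eqP; apply: contraT => /(sep1 _ (ends_vset G (aC1 : (a, b).1 \in C1))).
  by rewrite !in_setU (ends_vset G (aC2 : (a, b).1 \in C2)) orbT.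
case/eqP: neC; rewrite (loop_circuit cC1 aC1 a1).
by rewrite (loop_circuit cC2 aC2 a1).
Qed.
End Orientations.

Lemma odd_le2 i o : i + o = 2 -> 0 < i -> 0 < o -> odd i.
Proof. by case: i => [|[|i]] //; case: o => //; lia. Qed.

Lemma even_le2 i o : i + o = 2 -> ~~ odd i -> i = 0 /\ o = 2 \/ i = 2 /\ o = 0.
Proof. by case: i => [|[|[|i]]] //= io _; lia. Qed.

(** * Degrees, balance and orientations of barbells *)

Section Barbells.
Variables (V E : finType) (G : sgraph V E).
Implicit Types (F C P T : {set E}) (o D : {ffun E * bool -> bool}).

Lemma inoutdeg0 F o w : w \notin vset G F -> indeg G F o w = 0 /\ outdeg G F o w = 0.
Proof. by move/deg_eq0; have := inoutdeg G F o w; lia. Qed.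

Section OneBarbell.
Variables (C1 P C2 : {set E}) (v1 v2 : V).
Hypothesis bb : barbell_at G C1 P C2 v1 v2.
Let C := C1 :|: P :|: C2.

Let dis12 : [disjoint C1 :|: P & C2].
Proof.
by rewrite -setI_eq0 setIUl setU_eq0 !setI_eq0 (bb_dis12 bb) disjoint_sym (bb_dis2 bb).
Qed.

Lemma barbell_indeg o w :
  indeg G C o w = indeg G C1 o w + indeg G P o w + indeg G C2 o w.
Proof. by rewrite !indegU // (bb_dis1 bb). Qed.

Lemma barbell_outdeg o w :
  outdeg G C o w = outdeg G C1 o w + outdeg G P o w + outdeg G C2 o w.
Proof. by rewrite !outdegU // (bb_dis1 bb). Qed.

Lemma barbell_deg w : deg G C w = deg G C1 w + deg G P w + deg G C2 w.
Proof.
pose o : {ffun E * bool -> bool} := [ffun=> true].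
by rewrite -!(inoutdeg G _ o) barbell_indeg barbell_outdeg; lia.
Qed.

Lemma barbell_mem_vset w :
  (w \in vset G C) = [|| w \in vset G C1, w \in vset G P | w \in vset G C2].
Proof. by rewrite !vsetU !in_setU orbA. Qed.

Let circ1 : circuit G C1. Proof. by case/andP: (bb_circ1 bb). Qed.
Let circ2 : circuit G C2. Proof. by case/andP: (bb_circ2 bb). Qed.

(** The degree at [v1] is at least 3. This guarantees that no edge of a balanced circuit receives
    the weight 2. *)
Lemma barbell_not_circuit : ~~ circuit G C.
Proof.
apply/negP => cC; have := deg_circuit v1 cC; rewrite barbell_deg.
rewrite (deg_circuit _ circ1) (deg_circuit _ circ2) barbell_mem_vset (bb_v1 bb) /=.
have [e12|n12] := eqVneq v1 v2; first by rewrite e12 (bb_v2 bb); lia.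
by have [-> _] := path_ends (bb_path bb) n12.
Qed.

(* At each end of the barbell path, the two half-edges of the unbalanced
   circuit have the same direction (parity), so that they balance the weight 2
   of the path. *)
Lemma barbell_balance o : orientation G C o ->
    {in vset G C, forall w, 0 < indeg G C o w /\ 0 < outdeg G C o w} ->
  forall w, indeg G C1 o w + indeg G C2 o w + (indeg G P o w).*2 =
            outdeg G C1 o w + outdeg G C2 o w + (outdeg G P o w).*2.
Proof.
move=> oro pos.
have sC1 : C1 \subset C by rewrite /C -setUA subsetUl.
have sC2 : C2 \subset C by rewrite /C subsetUr.
(* Such a vertex meets no other part of the barbell, so the positivity in [C] is positivity in [C1],
   where its degree is 2. *)
have odd1 : {in vset G C1, forall w, w != v1 -> odd (indeg G C1 o w)}.
  move=> w wC wv; have := bb_sep1 bb wC wv; rewrite in_setU => /norP[wP wC2].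
  have := pos w; rewrite barbell_mem_vset wC barbell_indeg barbell_outdeg => /(_ isT).
  have := inoutdeg G C1 o w; rewrite deg_circuit // wC.
  have [-> ->] := inoutdeg0 o wP; have [-> ->] := inoutdeg0 o wC2.
  by rewrite !addn0 => io [ip op]; apply: odd_le2 io ip op.
have odd2 : {in vset G C2, forall w, w != v2 -> odd (indeg G C2 o w)}.
  move=> w wC wv; have := bb_sep2 bb wC wv; rewrite in_setU => /norP[wP wC1].
  have := pos w; rewrite barbell_mem_vset wC !orbT barbell_indeg barbell_outdeg => /(_ isT).
  have := inoutdeg G C2 o w; rewrite deg_circuit // wC.
  have [-> ->] := inoutdeg0 o wP; have [-> ->] := inoutdeg0 o wC1.
  by rewrite !add0n => io [ip op]; apply: odd_le2 io ip op.
have par1 := circuit_parity circ1 (orientationS sC1 oro) (bb_v1 bb) odd1.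
have par2 := circuit_parity circ2 (orientationS sC2 oro) (bb_v2 bb) odd2.
have [[_ un1] [_ un2]] := (andP (bb_circ1 bb), andP (bb_circ2 bb)).
have d1 := inoutdeg G C1 o v1; have d2 := inoutdeg G C2 o v2.
rewrite deg_circuit // (bb_v1 bb) in d1; rewrite deg_circuit // (bb_v2 bb) in d2.
rewrite un1 /= in par1; rewrite un2 /= in par2.
have {d1 par1} par1 := even_le2 d1 (negbT par1).
have {d2 par2} par2 := even_le2 d2 (negbT par2).
have zero F w : w \notin vset G F -> indeg G F o w = 0 /\ outdeg G F o w = 0.
  exact: inoutdeg0.
have one C' w : circuit G C' -> w \in vset G C' -> odd (indeg G C' o w) ->
    indeg G C' o w = 1 /\ outdeg G C' o w = 1.
  move=> cC' wC'; have := inoutdeg G C' o w; rewrite deg_circuit // wC'.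
  by move: (indeg _ _ _ _) (outdeg _ _ _ _); clear; case=> [|[|[|i]]] //=; lia.
move=> w; have := pos w; rewrite barbell_mem_vset barbell_indeg barbell_outdeg.
have dP := inoutdeg G P o w.
have [e12|n12] := eqVneq v1 v2.
  have P0 : P = set0 by have := bb_path bb; rewrite /is_path e12 eqxx => /eqP.
  have wP : w \notin vset G P by apply/vsetP => -[h]; rewrite P0 inE.
  have [-> ->] := zero P w wP.
  have [ew|nw] := eqVneq w v1.
    rewrite ew (bb_v1 bb) => /(_ isT); rewrite -e12 in par2; move: par1 par2.
    by do 2![case=> -[-> ->]] => // -[].
  have [wC1|wC1] := boolP (w \in vset G C1).
    have [-> ->] := one _ _ circ1 wC1 (odd1 w wC1 nw).
    have := bb_sep1 bb wC1 nw; rewrite in_setU => /norP[_ wC2].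
    by have [-> ->] := zero C2 w wC2.
  have [-> ->] := zero C1 w wC1; rewrite e12 in nw.
  have [wC2|wC2] := boolP (w \in vset G C2).
    by have [-> ->] := one _ _ circ2 wC2 (odd2 w wC2 nw).
  by have [-> ->] := zero C2 w wC2.
have [nv1 nv2] := bb_ne bb n12.
have [dP1 dP2] := path_ends (bb_path bb) n12.
have [ew|nw1] := eqVneq w v1.
  rewrite ew dP1 in dP *; rewrite (bb_v1 bb) => /(_ isT).
  have [-> ->] := zero C2 v1 nv1; move: par1 dP; clear.
  by move: (indeg G P o v1) (outdeg G P o v1) => iP oP; case=> -[-> ->]; lia.
have [ew|nw2] := eqVneq w v2.
  rewrite ew dP2 in dP *; rewrite (bb_v2 bb) !orbT => /(_ isT).
  have [-> ->] := zero C1 v2 nv2; move: par2 dP; clear.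
  by move: (indeg G P o v2) (outdeg G P o v2) => iP oP; case=> -[-> ->]; lia.
have [wC1|wC1] := boolP (w \in vset G C1).
  have := bb_sep1 bb wC1 nw1; rewrite in_setU => /norP[wP wC2].
  have [-> ->] := one _ _ circ1 wC1 (odd1 w wC1 nw1).
  by have [-> ->] := zero P w wP; have [-> ->] := zero C2 w wC2.
have [-> ->] := zero C1 w wC1.
have [wC2|wC2] := boolP (w \in vset G C2).
  have := bb_sep2 bb wC2 nw2; rewrite in_setU => /norP[wP _].
  have [-> ->] := one _ _ circ2 wC2 (odd2 w wC2 nw2).
  by have [-> ->] := zero P w wP.
have [-> ->] := zero C2 w wC2; move: dP; rewrite (path_inner (bb_path bb)) //.
case: (w \in _) => [|dP _]; last by move: dP; clear; lia.
move: (indeg G P o w) (outdeg G P o w); clear => iP oP dP /(_ isT); lia.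
Qed.

Lemma orient_barbell : exists2 o, orientation G C o &
  {in vset G C, forall w, 0 < indeg G C o w /\ 0 < outdeg G C o w}.
Proof.
have [[_ un1] [_ un2]] := (andP (bb_circ1 bb), andP (bb_circ2 bb)).
have [w wP|oP oriP odP] := @orientation_exists _ _ G P v1.
  have [e12|n12] := eqVneq v1 v2.
    have := bb_path bb; rewrite /is_path e12 eqxx => /eqP P0.
    by move: wP; rewrite P0 => /vsetP[h]; rewrite inE.
  have [dP1 dP2] := path_ends (bb_path bb) n12.
  have := bb_path bb; rewrite /is_path (negPf n12) => /and4P[/forall_inP/(_ w wP)].
  by move=> /forall_inP/(_ v1) + _ _ _; apply; rewrite -deg_gt0 dP1.
(* Each circuit is a sink at its end of the path if the path leaves that end, and a source
   otherwise. For a trivial path, [C1] is made a sink and [C2] a source at the common vertex. *)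
have [o1 or1 [in1]] := orient_circuit ((v1 == v2) || (indeg G P oP v1 == 0)) circ1 (bb_v1 bb).
have [o2 or2 [in2]] := orient_circuit ((v1 != v2) && (indeg G P oP v2 == 0)) circ2 (bb_v2 bb).
rewrite un1 un2 => -[i2 t2] [i1 t1].
pose o : {ffun E * bool -> bool} :=
  [ffun k => if k.1 \in C1 then o1 k else if k.1 \in C2 then o2 k else oP k].
have eo1 : {in C1, forall a b, o (a, b) = o1 (a, b)} by move=> a aC b; rewrite ffunE aC.
have eo2 : {in C2, forall a b, o (a, b) = o2 (a, b)}.
  by move=> a aC b; rewrite ffunE aC (disjointFl (bb_dis12 bb) aC).
have eoP : {in P, forall a b, o (a, b) = oP (a, b)}.
  by move=> a aC b; rewrite ffunE (disjointFl (bb_dis1 bb) aC) (disjointFl (bb_dis2 bb) aC).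
exists o.
  apply/forall_inP => a; rewrite !in_setU => /orP[/orP[]|] aF.
  - by rewrite !eo1 //; apply: (forall_inP or1).
  - by rewrite !eoP //; apply: (forall_inP oriP).
  - by rewrite !eo2 //; apply: (forall_inP or2).
move=> w; rewrite barbell_mem_vset barbell_indeg barbell_outdeg.
rewrite !(eq_indeg _ _ eo1, eq_indeg _ _ eo2, eq_indeg _ _ eoP).
rewrite !(eq_outdeg _ _ eo1, eq_outdeg _ _ eo2, eq_outdeg _ _ eoP).
have io := inoutdeg G P oP w.
have [e12|n12] := eqVneq v1 v2.
  have [ew|nw] := eqVneq w v1.
    rewrite -e12 eqxx in i2 t2; rewrite e12 eqxx -e12 in i1 t1.
    by rewrite ew i1 t1 i2 t2 /= !addn0 ?addn2.
  have P0 : P = set0 by have := bb_path bb; rewrite /is_path e12 eqxx => /eqP.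
  have wP : w \notin vset G P by apply/vsetP => -[h]; rewrite P0 inE.
  rewrite (negPf wP) /=; case/orP => wC.
    by have [-> ->] := in1 w wC nw.
  by rewrite e12 in nw; have [-> ->] := in2 w wC nw; split; apply: ltn_addl.
have [dP1 dP2] := path_ends (bb_path bb) n12.
have [ew|nw1] := eqVneq w v1.
  rewrite ew in io *; rewrite dP1 in io; rewrite i1 t1 (negPf n12) /= => _.
  by move: (indeg G P oP _) (outdeg G P oP _) io; clear => iP tP io; case: eqP => /=; lia.
have [ew|nw2] := eqVneq w v2.
  rewrite ew in io *; rewrite dP2 in io; rewrite i2 t2 n12 /= => _.
  by move: (indeg G P oP _) (outdeg G P oP _) io; clear => iP tP io; case: eqP => /=; lia.
case/or3P => wC; first by have [-> ->] := in1 w wC nw1.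
  have := odP w wC nw1; move: io; rewrite (path_inner (bb_path bb)) // wC.
  by move: (indeg G P oP _) (outdeg G P oP _); clear => iP tP; lia.
by have [-> ->] := in2 w wC nw2; split; apply: ltn_addl.
Qed.
End OneBarbell.

Lemma orient_signed_circuit C : signed_circuit G C -> exists2 o, orientation G C o &
  {in vset G C, forall w, 0 < indeg G C o w /\ 0 < outdeg G C o w}.
Proof.
case/orP => [/andP[cC /negPf evC]|].
  have [/set0Pn[a aC] _ _] := circuitP _ _ cC.
  have sC : ends G (a, true) \in vset G C by rewrite ends_vset.
  have [o oro [io]] := orient_circuit true cC sC; rewrite evC => -[is1 os1].
  exists o => // w wC; have [->|nw] := eqVneq w (ends G (a, true)); first by rewrite is1 os1.
  by have [-> ->] := io w wC nw.
case/existsP => P /existsP[C1 /existsP[C2 /andP[bC /eqP->]]].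
have [v1 [v2 bb]] := barbell_ofP bC; exact: orient_barbell bb.
Qed.

Lemma barbell_path_circuit C : circuit G C -> barbell_path G C = set0.
Proof.
move=> cC; rewrite /barbell_path; case: pickP => //= P.
case/existsP => C1 /existsP[C2 /andP[/barbell_ofP[v1 [v2 bb]] /eqP eC]].
by have := barbell_not_circuit bb; rewrite -eC cC.
Qed.

(** The decomposition belongs to the very path that [pick] returns, the one carrying the weight 2 in
    [fund_vector]. *)
Lemma barbell_pathP C : barbell G C -> exists C1 C2 v1 v2,
  barbell_at G C1 (barbell_path G C) C2 v1 v2 /\ C = C1 :|: barbell_path G C :|: C2.
Proof.
case/existsP => P bP; rewrite /barbell_path; case: pickP => [P'|/(_ P)]; last by rewrite bP.
case/existsP => C1 /existsP[C2 /andP[/barbell_ofP[v1 [v2 bb]] /eqP eC]].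
by exists C1, C2, v1, v2.
Qed.

(** * Boundaries of edge functions; integer flows on signed circuits *)

Local Open Scope ring_scope.

Definition sgn o h : int := if o h then 1 else -1.

Lemma sum_sgn F o w :
  \sum_(h in halfs G F w) sgn o h = (indeg G F o w)%:Z - (outdeg G F o w)%:Z.
Proof.
rewrite (bigID (fun h => o h)) /=; congr (_ + _).
  rewrite (eq_bigr (fun=> 1)) => [|h /andP[_ oh]]; last by rewrite /sgn oh.
  rewrite sumr_const natz; congr Posz; by apply: eq_card => h; rewrite in_set.
rewrite (eq_bigr (fun=> -1)) => [|h /andP[_ /negPf oh]]; last by rewrite /sgn oh.
rewrite sumr_const mulNrn natz; congr (- Posz _); by apply: eq_card => h; rewrite in_set.
Qed.

(** Inflow minus outflow, over any additive group so as to cover both integer vectors and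
    [Gam]-valued functions. *)
Definition bdy (M : zmodType) D (f : E -> M) (w : V) : M :=
  \sum_(h in halfs G [set: E] w) f h.1 *~ sgn D h.

Lemma is_flowP (Gam : finZmodType) D (f : {ffun E -> Gam}) :
  reflect (forall w, bdy D f w = 0) (is_flow G D f).
Proof.
have bdyE w : bdy D f w = \sum_(h in halfs G [set: E] w | D h) f h.1 -
                          \sum_(h in halfs G [set: E] w | ~~ D h) f h.1.
  rewrite /bdy (bigID (fun h => D h)) -sumrN /=.
  by congr (_ + _); apply: eq_bigr => h /andP[_ Dh]; rewrite /sgn ?Dh ?(negPf Dh).
apply: (iffP forallP) => H w; have := H w; rewrite bdyE.
  by move/eqP=> ->; rewrite subrr.
by move=> /eqP; rewrite subr_eq0.
Qed.

Lemma bdyD (M : zmodType) D (f g : E -> M) w :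
  bdy D (fun a => f a + g a) w = bdy D f w + bdy D g w.
Proof. by rewrite -big_split; apply: eq_bigr => h _; rewrite mulrzDl. Qed.

Lemma bdyB (M : zmodType) D (f g : E -> M) w :
  bdy D (fun a => f a - g a) w = bdy D f w - bdy D g w.
Proof. by rewrite -sumrB; apply: eq_bigr => h _; rewrite mulrzBl. Qed.

Lemma bdy_sum (M : zmodType) (I : Type) (r : seq I) (p : pred I) D (f : I -> E -> M) w :
  bdy D (fun a => \sum_(i <- r | p i) f i a) w = \sum_(i <- r | p i) bdy D (f i) w.
Proof. by rewrite exchange_big; apply: eq_bigr => h _; rewrite mulrz_suml. Qed.

Lemma eq_bdy (M : zmodType) D (f g : E -> M) w : f =1 g -> bdy D f w = bdy D g w.
Proof. by move=> fg; apply: eq_bigr => h _; rewrite fg. Qed.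

Lemma bdy_vscale (Gam : finZmodType) D (x : Gam) (u : {ffun E -> int}) w :
  bdy D (vscale x u) w = x *~ bdy D u w.
Proof.
by rewrite mulrz_sumr; apply: eq_bigr => h _; rewrite ffunE -mulrzA mulrzz.
Qed.

(* Every positive edge contributes [0] to the total boundary. *)
Lemma sum_bdy (M : zmodType) D (f : E -> M) : orientation G [set: E] D ->
  \sum_w bdy D f w = \sum_(a in neg G) f a *~ sgn D (a, false) *+ 2.
Proof.
move=> orD; rewrite big_halfs (bigID (mem (neg G))) /= [X in _ + X]big1 ?addr0.
  apply: eq_big => [a|a]; first by rewrite inE.
  rewrite inE /= => aN; have := forall_inP orD a (in_setT _).
  by rewrite aN /sgn => /eqP/eqP->; rewrite mulr2n.
move=> a /andP[_ /negPf aN]; have := forall_inP orD a (in_setT _).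
rewrite aN /sgn -mulrzDr.
by case: (D _); case: (D _) => //=; rewrite ?addNr ?subrr mulr0z.
Qed.

(** On both half-edges of [a], the factor [direction_sign D o a] turns [sgn D] into [sgn o], so [D]
    disappears from the boundary. *)
Lemma bdy_direction C D o (wt : E -> int) w :
    orientation G [set: E] D -> orientation G C o ->
  bdy D (fun a => if a \in C then direction_sign D o a * wt a else 0) w =
  \sum_(h in halfs G C w) wt h.1 * sgn o h.
Proof.
move=> orD oro; rewrite /bdy (bigID (fun h : E * bool => h.1 \in C)) /=.
rewrite [X in _ + X]big1 ?addr0 => [|h /andP[_ /negPf->]]; last by rewrite mul0rz.
apply: eq_big => [h|[a b] /andP[_ /= aC]]; first by rewrite !inE andbC.
rewrite aC mulrzz mulrAC [RHS]mulrC; congr (_ * _).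
rewrite /direction_sign /sgn; case: ifP => [/forallP/(_ b)/eqP->|/negbT nsame].
  by rewrite mul1r.
by rewrite (sameN_direction orD oro aC nsame) mulN1r; case: (o _); rewrite ?opprK.
Qed.

(** If an orientation without sinks and sources disagrees with [D] at [e], its reversal agrees there
    and still has neither; hence the [pick] succeeds. *)
Lemma fund_orientationP D C e : orientation G [set: E] D -> signed_circuit G C ->
    e \in C ->
  [/\ orientation G C (fund_orientation G D C e),
      same_direction D (fund_orientation G D C e) e &
      {in vset G C, forall w, (0 < indeg G C (fund_orientation G D C e) w)%N /\
                              (0 < outdeg G C (fund_orientation G D C e) w)%N}].
Proof.
move=> orD sC eC; rewrite /fund_orientation; case: pickP => [o|none] /=.
  by case/and3P => oro same /forall_inP pos; split=> // w /pos/andP.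
have [o oro pos] := orient_signed_circuit sC.
have {none}none o' : orientation G C o' -> same_direction D o' e ->
    {in vset G C, forall w, (0 < indeg G C o' w)%N /\ (0 < outdeg G C o' w)%N} -> False.
  move=> or' same' pos'; have := none o'; rewrite or' same' /= => /negP[].
  by apply/forall_inP => w /pos'/andP.
have := flip_same_direction orD oro eC => /orP[same|same].
  by case: (none o).
case: (none (flip o)) => //; first exact: flip_orientation.
by move=> w wC; rewrite indeg_flip outdeg_flip; have [] := pos w wC.
Qed.

Lemma big_halfsU F F' w (phi : E * bool -> int) : [disjoint F & F'] ->
  \sum_(h in halfs G (F :|: F') w) phi h =
  \sum_(h in halfs G F w) phi h + \sum_(h in halfs G F' w) phi h.
Proof.
move=> dF; rewrite -bigU ?halfs_disjoint //=.
by apply: eq_bigl => h; rewrite halfsU !inE.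
Qed.

Lemma signed_circuit_bdy D o C w : orientation G [set: E] D -> signed_circuit G C ->
    orientation G C o ->
    {in vset G C, forall w, (0 < indeg G C o w)%N /\ (0 < outdeg G C o w)%N} ->
  bdy D (fun a => if a \in C then
      direction_sign D o a * (if a \in barbell_path G C then 2 else 1) else 0) w = 0.
Proof.
move=> orD sC oro pos; rewrite bdy_direction //; case/orP: sC => [/andP[cC _]|bC].
  rewrite barbell_path_circuit // -[RHS](_ : \sum_(h in halfs G C w) sgn o h = 0).
    by apply: eq_bigr => h _; rewrite inE mul1r.
  rewrite sum_sgn; have := inoutdeg G C o w; rewrite deg_circuit //.
  have := pos w; case: (w \in _) => [/(_ isT)|_] /=; lia.
have [C1 [C2 [v1 [v2 [bb eC]]]]] := barbell_pathP bC.
move: (barbell_path G C) bb eC => P bb eC.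
have bal := @barbell_balance C1 P C2 v1 v2 bb o; rewrite -eC in bal.
have dis : [disjoint C1 :|: P & C2].
  by rewrite -setI_eq0 setIUl setU_eq0 !setI_eq0 (bb_dis12 bb) disjoint_sym (bb_dis2 bb).
rewrite {1}eC !big_halfsU ?(bb_dis1 bb) //.
have unit_wt F : [disjoint F & P] -> \sum_(h in halfs G F w)
    (if h.1 \in P then 2 else 1) * sgn o h = \sum_(h in halfs G F w) sgn o h.
  move=> dF; apply: eq_bigr => h; rewrite in_halfs => /andP[hF _].
  by rewrite (disjointFr dF hF) mul1r.
rewrite (unit_wt C1) ?(bb_dis1 bb) // (unit_wt C2) ?(bb_dis2 bb) //.
have -> : \sum_(h in halfs G P w) (if h.1 \in P then 2 else 1) * sgn o h =
    2 * \sum_(h in halfs G P w) sgn o h.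
  by rewrite mulr_sumr; apply: eq_bigr => h; rewrite in_halfs => /andP[->].
rewrite !sum_sgn.
have := bal oro pos w; clear; lia.
Qed.
End Barbells.

(** * Signed circuits in a spanning tree with two more edges *)

Section Trees.
Variables (V E : finType) (G : sgraph V E).
Implicit Types (F C P T : {set E}) (o D : {ffun E * bool -> bool}).

Lemma connect_pendant F h x y : h.1 \in F -> deg G F (ends G h) = 1 ->
    x != ends G h -> y != ends G h ->
  connect (adj G F) x y -> connect (adj G (F :\ h.1)) x y.
Proof.
move=> hF dw xw yw cxy; set w := ends G h in dw xw yw *.
have only k : k.1 \in F -> ends G k = w -> k = h.
  move=> kF kw; have /eqP/cards1P[k0 e0] := dw.
  have : k \in halfs G F w by rewrite in_halfs kF kw eqxx.
  have : h \in halfs G F w by rewrite in_halfs hF eqxx.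
  by rewrite e0 !inE => /eqP-> /eqP.
pose z' := ends G (h.1, ~~ h.2); have nz' : (z' == w) = false.
  apply/eqP => /(only (h.1, ~~ h.2) hF)/(congr1 snd) /=; by case: (h.2).
(* A walk may step to the pendant vertex [w] and back; the invariant treats being at [w] as being at
   its only neighbour [z']. *)
pose A z := if z == w then connect (adj G (F :\ h.1)) x z' else connect (adj G (F :\ h.1)) x z.
suff : A y by rewrite /A (negPf yw).
apply: (connect_adj_ind (A := A) _ cxy); last by rewrite /A (negPf xw) connect0.
move=> k kF; rewrite /A; have [ekh|nkh] := eqVneq k.1 h.1.
  have [ek|nk] := eqVneq k h; first by rewrite ek eqxx -/z' nz'.
  have ek : k = (h.1, ~~ h.2).
    by case: h k ekh nk {w dw xw yw A z' nz' only hF kF} => a b [a' b'] /= ->;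
      rewrite xpair_eqE eqxx /=; case: b; case: b'.
  by rewrite ek /= negbK -/z' nz' -surjective_pairing eqxx.
have nw b : (ends G (k.1, b) == w) = false.
  by apply/eqP => /(only (k.1, b) kF)/(congr1 fst) /= /eqP; rewrite (negPf nkh).
have := nw k.2; rewrite -surjective_pairing => ->; rewrite nw => cx.
apply: connect_trans cx (connect1 _); apply: adj_ends.
by rewrite !inE nkh.
Qed.

(* Take an inclusion-minimal [P] joining [S1] to [S2] in [T]: the only possible
   vertices of degree 1 are the ends, and the degree sum is at most
   [2 * #|vset P| - 2] since [P] is a forest. *)
Lemma joining_path T (S1 S2 : {set V}) :
    spanning_tree G T -> S1 != set0 -> S2 != set0 -> [disjoint S1 & S2] ->
  exists P v1 v2, [/\ P \subset T, v1 \in S1, v2 \in S2, is_path G P v1 v2 &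
    forall w, w \in vset G P -> (w \in S1 -> w = v1) /\ (w \in S2 -> w = v2)].
Proof.
case/spanning_treeP => conT forT /set0Pn[s1 s1S] /set0Pn[s2 s2S] dS.
pose joins P := [exists x in S1, exists y in S2, connect (adj G P) x y].
have joinsP P x y : x \in S1 -> y \in S2 -> connect (adj G P) x y -> joins P.
  by move=> xS yS cxy; apply/exists_inP; exists x => //; apply/exists_inP; exists y.
have [|P /minsetP[/exists_inP[v1 v1S /exists_inP[v2 v2S c12]] minP] sPT] := @minset_exists _ joins T.
  exact: joinsP (conT s1 s2).
have minD a x y : a \in P -> x \in S1 -> y \in S2 -> ~~ connect (adj G (P :\ a)) x y.
  move=> aP xS yS; apply/negP => /(joinsP _ _ _ xS yS)/minP/(_ (subD1set _ _)) eP.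
  by move: aP; rewrite -eP !inE eqxx.
exists P, v1, v2.
have n12 : v1 != v2 by apply: contraTneq v2S => <-; rewrite (disjointFr dS).
(* The edges of [P] in the component of [v1] already join [v1] to [v2], so by minimality they are
   all of [P]. *)
have conP u : u \in vset G P -> connect (adj G P) v1 u.
  pose P' := [set a in P | connect (adj G P) v1 (ends G (a, true))].
  have inP' h : h.1 \in P -> (h.1 \in P') = connect (adj G P) v1 (ends G h).
    case: h => a [] /= aP; rewrite inE aP //=.
    apply/idP/idP => H; apply: connect_trans H (connect1 _).
      exact: (adj_ends G (aP : (a, true).1 \in P)).
    exact: (adj_ends G (aP : (a, false).1 \in P)).
  suff eP : P' = P by case/vsetP => h hP <-; rewrite -inP' // eP.
  apply: minP; last by apply/subsetP => a; rewrite inE => /andP[].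
  apply: (joinsP _ _ _ v1S v2S).
  have [] // : connect (adj G P) v1 v2 /\ connect (adj G P') v1 v2.
  apply: (connect_adj_ind (A := fun z => connect (adj G P) v1 z /\ connect (adj G P') v1 z) _ c12).
    move=> h hP [c1 c2]; split; first exact: connect_trans c1 (connect1 (adj_ends G hP)).
    by apply: connect_trans c2 (connect1 (adj_ends G _)); rewrite inP'.
  by split; apply: connect0.
have v1P : v1 \in vset G P.
  apply: contraNT n12 => v1P; apply/eqP/esym.
  apply: (connect_adj_ind (A := fun z => z = v1) _ c12) => // h hP hv.
  by move: v1P; rewrite -hv ends_vset.
have v2P : v2 \in vset G P by apply: connect_vset c12 v1P.
have pend u : u \in vset G P -> deg G P u = 1 -> exists2 a, a \in P &
    forall x y, x != u -> y != u -> connect (adj G P) x y -> connect (adj G (P :\ a)) x y.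
  case/vsetP => h hP hu du; exists h.1 => // x y; rewrite -hu in du *.
  exact: connect_pendant.
have ge2 u : u \in vset G P -> (if (u == v1) || (u == v2) then 1 else 2) <= deg G P u.
  move=> uP; have := deg_gt0 G P u; rewrite uP.
  have [//|nu1] := eqVneq u v1; have [//|nu2] := eqVneq u v2.
  rewrite leq_eqVlt => /orP[/eqP/esym du|//].
  have [a aP conA] := pend u uP du.
  by case/negP: (minD a v1 v2 aP v1S v2S); apply: conA; rewrite // eq_sym.
have P0 : P != set0.
  by have [h hP _] := vsetP _ _ _ v1P; apply/set0Pn; exists h.1.
have sumb : \sum_(u in vset G P) (if (u == v1) || (u == v2) then 1 else 2) + 2 = #|vset G P|.*2.
  rewrite (bigD1 v1) //= eqxx (bigD1 v2) /=; last by rewrite v2P eq_sym.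
  rewrite eqxx orbT (eq_bigr (fun=> 2)) => [|u /andP[/andP[_ /negPf->] /negPf->] //].
  rewrite sum_nat_const (cardsD1 v1) v1P (cardsD1 v2 (_ :\ _)) in_setD1 v2P eq_sym n12.
  set X := #|_|; set Y := #|_|; have -> : X = Y.
    by apply: eq_card => u; rewrite !in_setD1 /in_mem /=; do 2![case: (u == _)]; rewrite ?andbF ?andbT.
  by clear; lia.
have degP u : u \in vset G P -> deg G P u = if (u == v1) || (u == v2) then 1 else 2.
  have := sum_deg_vset G P; have := forest_card (forestS sPT forT) P0 => lt sumP.
  have := leqif_sum (fun u uC => leqif_eq (ge2 u uC)) => -[le eq].
  have /esym := eq; have -> : (\sum_(u in vset G P) (if (u == v1) || (u == v2) then 1 else 2) ==
     \sum_(u in vset G P) deg G P u) by apply/eqP; move: le lt sumP sumb; clear; lia.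
  by move=> /forall_inP H /H/eqP.
split=> //.
  rewrite /is_path (negPf n12); apply/and4P; split.
  - apply/forall_inP => u uP; apply/forall_inP => w wP.
    by apply: connect_trans (conP w wP); rewrite connect_adj_sym conP.
  - by rewrite degP // eqxx.
  - by rewrite degP // eqxx orbT.
  - by apply/forall_inP => u uP; apply/implyP => /andP[/negPf nu1 /negPf nu2]; rewrite degP // nu1 nu2.
(* Another vertex of [S1] on [P] could replace [v1], and the pendant edge at [v1] could be dropped,
   against minimality; likewise for [S2] and [v2]. *)
move=> w wP; split=> wS; apply/eqP; apply: contraT => nw.
  have [|a aP conA] := pend v1 v1P; first by rewrite degP // eqxx.
  case/negP: (minD a w v2 aP wS v2S); apply: conA; rewrite // 1?eq_sym //.
  by apply: connect_trans c12; rewrite connect_adj_sym conP.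
have [|a aP conA] := pend v2 v2P; first by rewrite degP // eqxx orbT.
by case/negP: (minD a v1 w aP v1S wS); apply: conA; rewrite // conP.
Qed.

Lemma spanning_tree_circuit T e : spanning_tree G T -> e \notin T ->
  exists2 C : {set E}, C \subset e |: T & circuit G C.
Proof.
move=> tT eT; apply: dense_circuit.
  by apply/set0Pn; exists e; rewrite setU11.
by rewrite cardsU1 eT add1n (spanning_tree_card (ends G (e, true)) tT) max_card.
Qed.

Lemma tree_edge_circuit_neg T C e : [disjoint T & neg G] -> C \subset e |: T -> e \in C ->
  #|C :&: neg G| = (e \in neg G).
Proof.
move=> posT sC eC; case: (boolP (e \in neg G)) => eN.
  apply/eqP/cards1P; exists e; apply/setP => a; rewrite !inE; apply/andP/eqP => [[aC aN]|-> //].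
  by have := subsetP sC a aC; rewrite !inE => /orP[/eqP//|/(disjointFr posT)]; rewrite aN.
apply/eqP; rewrite cards_eq0; apply/eqP/setP => a; rewrite !inE; apply/andP => -[aC aN].
have := subsetP sC a aC; rewrite !inE => /orP[/eqP ea|/(disjointFr posT)]; last by rewrite aN.
by rewrite -ea aN in eN.
Qed.

(* If [e] is negative, then the circuits [C0] of [T + e0] and [C1] of [T + e] are
   unbalanced.  Either their symmetric difference contains a circuit through both
   [e0] and [e], which is balanced, or [C0] and [C1] are edge-disjoint; in the
   latter case they have at most one common vertex, for otherwise their union
   without [e0] and [e] would be too dense for a forest. *)
Lemma signed_circuit_exists T e0 e :
    spanning_tree G T -> [disjoint T & neg G] -> e0 \in neg G -> e \notin e0 |: T ->
  exists2 C : {set E}, signed_circuit G C & C \subset e |: (e0 |: T).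
Proof.
move=> tT posT e0N; rewrite in_setU1 negb_or => /andP[ne eT].
have [conT forT] := spanning_treeP _ _ tT.
have [C1 sC1 cC1] := spanning_tree_circuit tT eT.
have eC1 := forest_circuit_mem forT cC1 sC1.
have sub1 : C1 \subset e |: (e0 |: T) by apply: subset_trans sC1 _; rewrite setUS ?subsetUr.
have [eN|eN] := boolP (e \in neg G); last first.
  exists C1 => //; apply/orP; left.
  by rewrite /balanced_circuit cC1 (tree_edge_circuit_neg posT sC1 eC1) (negPf eN).
have e0T : e0 \notin T by apply/negP => /(disjointFr posT); rewrite e0N.
have [C0 sC0 cC0] := spanning_tree_circuit tT e0T.
have e0C0 := forest_circuit_mem forT cC0 sC0.
have sub0 : C0 \subset e |: (e0 |: T) by apply: subset_trans sC0 _; rewrite subsetUr.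
have e0C1 : e0 \notin C1.
  by apply: contra e0T => /(subsetP sC1); rewrite in_setU1 eq_sym (negPf ne).
have eC0 : e \notin C0.
  by apply: contra eT => /(subsetP sC0); rewrite in_setU1 (negPf ne).
have ne10 : C0 != C1 by apply: contraNneq eC0 => ->.
have [B sB cB] := circuits_symdiff cC0 cC1 ne10.
have subB : B \subset e |: (e0 |: T).
  by apply: subset_trans sB _; rewrite subUset !(subset_trans (subsetDl _ _)).
have [/andP[eB e0B]|nB] := boolP ((e \in B) && (e0 \in B)).
  exists B => //; apply/orP; left; rewrite /balanced_circuit cB /=.
  suff -> : B :&: neg G = [set e; e0] by rewrite cards2 ne.
  apply/setP => a; rewrite !inE; apply/andP/orP => [[aB aN]|[]/eqP-> //].
  have := subsetP subB a aB; rewrite !inE => /or3P[->|->|/(disjointFr posT)]; [by left|by right|].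
  by rewrite aN.
(* [B] misses [e0] or [e], so [unicyclic] identifies it with [C1] or [C0]; that circuit then lies in
   the symmetric difference, away from the other one. *)
have dis : [disjoint C0 & C1].
  have [eB|eB] := boolP (e \in B).
    have sB1 : B \subset e |: T.
      apply/subsetP => a aB; have := subsetP subB a aB; rewrite !inE.
      by case/or3P => [->//|/eqP ea|->]; rewrite ?orbT //; rewrite -ea eB aB in nB.
    have eBC : B = C1 := unicyclic forT cB sB1 cC1 sC1.
    rewrite disjoint_sym disjoint_subset; apply/subsetP => a aC; rewrite inE.
    by have := subsetP sB a; rewrite eBC aC !inE aC /= => /(_ isT); case: (a \in C0).
  have sB0 : B \subset e0 |: T.
    apply/subsetP => a aB; have := subsetP subB a aB; rewrite !inE.
    by case/or3P => [/eqP ea|->//|->]; rewrite ?orbT //; rewrite -ea aB in eB.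
  have eBC : B = C0 := unicyclic forT cB sB0 cC0 sC0.
  rewrite disjoint_subset; apply/subsetP => a aC; rewrite inE.
  by have := subsetP sB a; rewrite eBC aC !inE aC /= => /(_ isT); case: (a \in C1).
have un1 : unbalanced_circuit G C1.
  by rewrite /unbalanced_circuit cC1 (tree_edge_circuit_neg posT sC1 eC1) eN.
have un0 : unbalanced_circuit G C0.
  by rewrite /unbalanced_circuit cC0 (tree_edge_circuit_neg posT sC0 e0C0) e0N.
suff [P [sP bP]] : exists P, P \subset T /\ barbell_of G C0 P C1.
  exists (C0 :|: P :|: C1).
    apply/orP; right; apply/existsP; exists P; apply/existsP; exists C0.
    by apply/existsP; exists C1; rewrite bP eqxx.
  rewrite !subUset sub0 sub1 andbT /=; apply: subset_trans sP _.
  by apply: subset_trans (subsetUr _ _) (subsetUr _ _).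
have [V0|V0] := eqVneq (vset G C0 :&: vset G C1) set0.
  have dV : [disjoint vset G C0 & vset G C1] by rewrite -setI_eq0 V0.
  have ne_vset C a : a \in C -> vset G C != set0.
    by move=> aC; apply/set0Pn; exists (ends G (a, true)); rewrite ends_vset.
  have [P [v1 [v2 [sP v1C v2C pP sep]]]] :=
    joining_path tT (ne_vset _ _ e0C0) (ne_vset _ _ eC1) dV.
  exists P; split=> //; rewrite /barbell_of un0 un1 ne10 /=.
  apply/exists_inP; exists v1 => //; apply/exists_inP; exists v2 => //.
  rewrite pP /=; apply/andP; split; rewrite disjoint_subset; apply/subsetP => w;
    rewrite in_setD1 => /andP[wv wC]; rewrite inE !in_setU !in_set1 (negPf wv) /=.
    rewrite (disjointFr dV wC) orbF negb_or; apply/andP; split.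
      by apply: contraTneq wC => ->; rewrite (disjointFl dV).
    by apply: contraNN wv => /sep[/(_ wC)->].
  rewrite (disjointFl dV wC) !orbF negb_or; apply/andP; split.
    by apply: contraTneq wC => ->; rewrite (disjointFr dV).
  by apply: contraNN wv => /sep[_ /(_ wC)->].
have [x xI] := set0Pn _ V0.
have card1 : #|vset G C0 :&: vset G C1| <= 1.
  set F := (C0 :|: C1) :\ e :\ e0.
  have cardF : #|F|.+2 = #|C0| + #|C1|.
    rewrite -cardsUI; move: dis; rewrite -setI_eq0 => /eqP->; rewrite cards0 addn0.
    rewrite (cardsD1 e (C0 :|: C1)) (cardsD1 e0 ((C0 :|: C1) :\ e)) in_setD1 !in_setU.
    by rewrite eC1 e0C0 eq_sym ne orbT.
  have cardV := cardsUI (vset G C0) (vset G C1).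
  rewrite !circuit_card // -vsetU in cardV.
  have sFT : F \subset T.
    apply/subsetP => a; rewrite !inE => /and3P[/negPf n1 /negPf n2 /orP[/(subsetP sC0)|/(subsetP sC1)]].
      by rewrite in_setU1 n1.
    by rewrite in_setU1 n2.
  (* The forest bound needs a nonempty set; if [F] is empty, both circuits are loops with one vertex
     each. *)
  have [F0|F0] := eqVneq F set0.
    rewrite F0 cards0 in cardF; apply: leq_trans (subset_leq_card (subsetIl _ _)) _.
    have c0 : 0 < #|C0| by rewrite (cardsD1 e0) e0C0.
    have c1 : 0 < #|C1| by rewrite (cardsD1 e) eC1.
    by rewrite circuit_card //; move: cardF c0 c1; clear; lia.
  have lt := forest_card (forestS sFT forT) F0.
  have le : #|vset G F| <= #|vset G (C0 :|: C1)|.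
    by apply/subset_leq_card/subset_vset; rewrite !(subset_trans (subsetDl _ _)).
  by move: cardF cardV lt le; clear; lia.
have atx w : w \in vset G C0 -> w \in vset G C1 -> w = x.
  by move=> w0 w1; apply: (card_le1_eqP card1) => //; rewrite inE w0.
move: xI; rewrite inE => /andP[x0 x1].
exists set0; split; first exact: sub0set.
rewrite /barbell_of un0 un1 ne10 /=; apply/exists_inP; exists x => //.
apply/exists_inP; exists x => //; rewrite /is_path !eqxx /=.
have vs0 w : w \in vset G (set0 : {set E}) = false by apply/vsetP => -[h]; rewrite inE.
apply/andP; split; rewrite disjoint_subset; apply/subsetP => w;
    rewrite in_setD1 => /andP[wv wC]; rewrite inE !in_setU vs0 !in_set1 (negPf wv) /=.
  by apply: contraNN wv => /(atx _ wC)->.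
by apply: contraNN wv => wC0; rewrite (atx _ wC0 wC).
Qed.
End Trees.

(** * Flows *)

Section MainFlows.
Local Open Scope ring_scope.
Variables (V E : finType) (G : sgraph V E).
Implicit Types (F C P : {set E}) (o : {ffun E * bool -> bool}).

(** A nonempty support inside a forest has a vertex of degree 1, where conservation forces the value
    on its only edge to vanish. *)
Lemma forest_flow_eq0 (M : zmodType) D F (f : E -> M) : forest G F ->
    (forall w, bdy G D f w = 0) -> (forall a, a \notin F -> f a = 0) -> f =1 fun=> 0.
Proof.
move=> forF flowf suppf; pose S := [set a | f a != 0].
have sSF : S \subset F.
  by apply/subsetP => a; rewrite inE; apply: contraR => /suppf->.
suff S0 : S = set0.
  by move=> a; apply/eqP; move/setP/(_ a): S0; rewrite !inE => /negbFE.
apply/eqP; apply: contraT => S0.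
have [w|C sC cC] := @deg_ge2_circuit _ _ G S S0; last first.
  by have := forF C (subset_trans sC sSF); rewrite cC.
rewrite -deg_gt0 leq_eqVlt => /orP[/eqP/esym dw|//].
have /eqP/cards1P[h eh] := dw.
have : h \in halfs G S w by rewrite eh inE.
rewrite in_halfs => /andP[hS /eqP hw].
have := flowf w; rewrite /bdy (bigD1 h) ?in_halfs ?inE ?hw //= big1 ?addr0.
  by move: hS; rewrite inE /sgn; case: (D h) => nz /eqP; rewrite ?mulrN1z ?oppr_eq0 (negPf nz).
move=> k /andP[]; rewrite in_halfs => /andP[_ kw] nk.
have : k \notin halfs G S w by rewrite eh inE.
by rewrite in_halfs kw andbT inE negbK => /eqP->; rewrite mul0rz.
Qed.

Variables (D : {ffun E * bool -> bool}) (T : {set E}) (e0 : E) (v : V).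
Hypothesis orD : orientation G [set: E] D.
Hypothesis treeT : spanning_tree G T.
Hypothesis posT : [disjoint T & neg G].
Hypothesis e0N : e0 \in neg G.
Let T0 := e0 |: T.
Hypothesis vC0 : v \in vset G (root_circuit G T0).

Let forT : forest G T. Proof. by case/spanning_treeP: treeT. Qed.

(** The default [set0] has no vertex, so [vC0] shows that the [pick] succeeded. *)
Lemma root_circuitP : circuit G (root_circuit G T0) /\ root_circuit G T0 \subset T0.
Proof.
move: vC0; rewrite /root_circuit; case: pickP => [C /andP[] //|_] /=.
by case/vsetP => h; rewrite inE.
Qed.

Lemma root_edge_mem C : circuit G C -> C \subset T0 -> e0 \in C.
Proof. exact: forest_circuit_mem. Qed.

Lemma circuit_root_neg C : circuit G C -> C \subset T0 -> #|C :&: neg G| = 1.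
Proof. by move=> cC sC; rewrite (tree_edge_circuit_neg posT sC) ?e0N // root_edge_mem. Qed.

(* The total boundary of the root circuit is twice the direction of its only
   negative edge, so that [e0] is extroverted as soon as [v] has indegree 2. *)
Lemma root_orientationP (o := root_orientation G D (root_circuit G T0) e0 v) :
  [/\ orientation G (root_circuit G T0) o, indeg G (root_circuit G T0) o v = 2,
      outdeg G (root_circuit G T0) o v = 0 &
      {in vset G (root_circuit G T0), forall w, w != v ->
        indeg G (root_circuit G T0) o w = 1 /\ outdeg G (root_circuit G T0) o w = 1}].
Proof.
rewrite /o /root_orientation; case: pickP => [o1|none] /=.
  case/and4P => oro _ /andP[/eqP-> /eqP->] /forall_inP bal; split=> // w wC wv.
  by have := bal w; rewrite in_setD1 wv wC => /(_ isT)/andP[/eqP-> /eqP->].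
have [cC sC] := root_circuitP; set C := root_circuit G T0 in cC sC none *.
have e0C := root_edge_mem cC sC.
have [o1 oro [bal]] := orient_circuit true cC vC0.
rewrite circuit_root_neg //= => -[iv ov]; have := none o1.
rewrite oro iv ov /=; case/negP; apply/andP; split; last first.
  apply/forall_inP => w; rewrite in_setD1 => /andP[wv wC].
  by have [-> ->] := bal w wC wv.
have := big_halfs G C (sgn o1); rewrite (bigD1 v) //= [X in _ + X = _]big1 => [|w wv]; last first.
  rewrite sum_sgn; have [wC|wC] := boolP (w \in vset G C).
    by have [-> ->] := bal w wC wv.
  by have [-> ->] := inoutdeg0 o1 wC.
rewrite addr0 sum_sgn iv ov (bigD1 e0) //= [X in _ = _ + X]big1 => [|a /andP[aC ae0]].
  have := forall_inP oro e0 e0C; rewrite e0N /sgn => /eqP/eqP <-.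
  by case: (o1 _).
have := forall_inP oro a aC.
have /negPf-> : a \notin neg G.
  by have := subsetP sC a aC; rewrite !inE (negPf ae0) => /(disjointFr posT)->.
by rewrite /sgn; case: (o1 _); case: (o1 _).
Qed.

Let g := root_vector G D T0 e0 v.

Lemma root_vector_supp a : a \notin T0 -> g a = 0.
Proof.
by move=> aT; have [_ /subsetP sC] := root_circuitP; rewrite ffunE (contraNF (sC a) aT).
Qed.

(** The sign of [g] at [e0] depends on [D]; in this form [g e0] is its own inverse, so a coefficient
    is recovered by multiplying by it again. *)
Lemma root_vector_sq : g e0 * g e0 = 1.
Proof.
have [cC sC] := root_circuitP; rewrite ffunE (root_edge_mem cC sC) /direction_sign.
by case: ifP.
Qed.

Lemma root_vector_bdy w : bdy G D g w = if w == v then 2 else 0.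
Proof.
have [oro iv ov bal] := root_orientationP.
have [cC sC] := root_circuitP.
set C := root_circuit G T0 in cC sC oro iv ov bal *.
set o := root_orientation G D C e0 v in oro iv ov bal *.
rewrite (eq_bdy G D w (g := fun a => if a \in C then direction_sign D o a * 1 else 0)); last first.
  by move=> a; rewrite ffunE mulr1.
rewrite (bdy_direction (fun=> 1) w orD oro); under eq_bigr do rewrite mul1r.
rewrite sum_sgn; have [->|wv] := eqVneq w v; first by rewrite iv ov.
have [wC|wC] := boolP (w \in vset G C); first by have [-> ->] := bal w wC wv.
by have [-> ->] := inoutdeg0 o wC.
Qed.

Lemma disjoint_root_circuits C C' : circuit G C -> circuit G C' -> [disjoint C & C'] ->
  C \subset T0 -> C' \subset T0 -> False.
Proof.
move=> cC cC' dC sC sC'.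
by have := disjointFr dC (root_edge_mem cC sC); rewrite root_edge_mem.
Qed.

Section FundamentalVector.
Variable e : E.
Hypothesis eT0 : e \notin T0.
Let C := fund_circuit G T0 e.

Let fund_circuitP : signed_circuit G C /\ C \subset e |: T0.
Proof.
rewrite /C /fund_circuit; case: pickP => [C' /andP[] //|none].
by have [C' sC sub] := signed_circuit_exists treeT posT e0N eT0; have := none C'; rewrite sC sub.
Qed.

Let sub_T0 F : F \subset C -> e \notin F -> F \subset T0.
Proof.
move=> sF eF; apply/subsetP => a aF; have [_ /subsetP sC] := fund_circuitP.
have := sC a (subsetP sF a aF); rewrite in_setU1 => /orP[/eqP ea|//].
by rewrite -ea aF in eF.
Qed.

(** Otherwise the signed circuit lies in [T0], where every circuit passes through [e0] and is
    unbalanced: it can be neither a balanced circuit nor contain two disjoint circuits. *)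
Lemma fund_circuit_mem : e \in C.
Proof.
have [sgC sC] := fund_circuitP; apply: contraT => eC; have sC0 := sub_T0 (subxx C) eC.
case/orP: sgC => [/andP[cC]|/barbell_pathP[C1 [C2 [v1 [v2 [bb eqC]]]]]].
  by rewrite circuit_root_neg.
have [[c1 _] [c2 _]] := (andP (bb_circ1 bb), andP (bb_circ2 bb)).
case: (disjoint_root_circuits c1 c2 (bb_dis12 bb)); apply: subset_trans sC0; rewrite eqC.
  by rewrite -setUA subsetUl.
by rewrite subsetUr.
Qed.

(** With [e] on the path, both circuits of the barbell would be disjoint circuits of [T0]. This
    makes the value at [e] equal to 1; a value 2 would determine coefficients only up to
    2-torsion. *)
Lemma fund_path_mem : e \notin barbell_path G C.
Proof.
have [/orP[/andP[cC _]|bC] sC] := fund_circuitP.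
  by rewrite barbell_path_circuit // inE.
apply/negP => eP; have [C1 [C2 [v1 [v2 [bb eqC]]]]] := barbell_pathP bC.
have [[c1 _] [c2 _]] := (andP (bb_circ1 bb), andP (bb_circ2 bb)).
case: (disjoint_root_circuits c1 c2 (bb_dis12 bb)); apply: sub_T0.
- by rewrite eqC -setUA subsetUl.
- by rewrite (disjointFl (bb_dis1 bb)).
- by rewrite eqC subsetUr.
by rewrite (disjointFl (bb_dis2 bb)).
Qed.

Lemma fund_vector_self : fund_vector G D T0 e e = 1.
Proof.
have [sgC _] := fund_circuitP.
have [_ same _] := fund_orientationP orD sgC fund_circuit_mem.
rewrite ffunE -/C fund_circuit_mem (negPf fund_path_mem) /direction_sign.
by rewrite same.
Qed.

Lemma fund_vector_supp a : a \notin T0 -> a != e -> fund_vector G D T0 e a = 0.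
Proof.
move=> aT ae; have [_ /subsetP sC] := fund_circuitP; rewrite ffunE -/C.
by rewrite (contraNF (sC a)) // in_setU1 negb_or ae.
Qed.

Lemma fund_vector_bdy w : bdy G D (fund_vector G D T0 e) w = 0.
Proof.
have [sgC _] := fund_circuitP.
have [oro _ pos] := fund_orientationP orD sgC fund_circuit_mem.
rewrite -[RHS](signed_circuit_bdy w orD sgC oro pos).
by apply: eq_bdy => a; rewrite ffunE.
Qed.
End FundamentalVector.

(** * Coordinates of [Gam]-flows and counting *)

Variable Gam : finZmodType.
Local Notation comb := (@flow_comb _ _ G Gam D T0 e0 v).

Lemma vscaleE (x : Gam) (u : {ffun E -> int}) a : vscale x u a = x *~ u a.
Proof. by rewrite ffunE. Qed.

Lemma flow_combE x c a : comb x c a =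
  x *~ g a + \sum_(e in ~: T0) c e *~ fund_vector G D T0 e a.
Proof.
rewrite !ffunE; congr (_ + _); rewrite sum_ffunE.
by apply: eq_bigr => e _; rewrite ffunE.
Qed.

Lemma flow_comb_coord x c e : e \notin T0 -> comb x c e = c e.
Proof.
move=> eT; rewrite flow_combE root_vector_supp // mulr0z add0r.
have self := fund_vector_self eT.
have supp b (bT : b \notin T0) := fund_vector_supp bT eT.
move: (fund_vector G D T0) self supp => f self supp.
rewrite (bigD1 e) ?in_setC // self mulr1z big1; first exact: addr0.
by move=> b /andP[]; rewrite in_setC => bT be; rewrite supp ?mulr0z // eq_sym.
Qed.

Lemma flow_comb_inj x x' c c' : comb x c = comb x' c' ->
  x = x' /\ forall e, e \notin T0 -> c e = c' e.
Proof.
move=> eqf; have eqc e : e \notin T0 -> c e = c' e.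
  by move=> eT; rewrite -(flow_comb_coord x c eT) eqf flow_comb_coord.
split=> //; have := congr1 (fun f : {ffun E -> Gam} => f e0 *~ g e0) eqf.
rewrite !flow_combE (eq_bigr (fun e => c' e *~ fund_vector G D T0 e e0)); last first.
  by move=> e; rewrite inE => eT; rewrite eqc.
by rewrite !mulrzDl => /addIr; rewrite -!mulrzA root_vector_sq !mulr1z.
Qed.

(** For arbitrary [x] the only defect is [x *+ 2] at [v], which is where [Gamma2] comes from. *)
Lemma bdy_flow_comb x c w : bdy G D (comb x c) w = if w == v then x *+ 2 else 0.
Proof.
rewrite (eq_bdy G D w (flow_combE x c)) bdyD bdy_sum big1 ?addr0 => [|e].
  rewrite (eq_bdy G D w (g := vscale x g)) => [|a]; last by rewrite vscaleE.
  by rewrite bdy_vscale root_vector_bdy; case: eqP.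
rewrite inE => eT; rewrite (eq_bdy G D w (g := vscale (c e) (fund_vector G D T0 e))).
  by rewrite bdy_vscale fund_vector_bdy // mulr0z.
by move=> a; rewrite vscaleE.
Qed.

Lemma flow_comb_is_flow x c : x \in Gamma2 Gam -> is_flow G D (comb x c).
Proof.
rewrite inE => /eqP x2; apply/is_flowP => w; rewrite bdy_flow_comb x2.
by case: ifP.
Qed.

Lemma flow_is_comb f : is_flow G D f -> exists2 x, x \in Gamma2 Gam & exists c, f = comb x c.
Proof.
move=> /is_flowP flowf; pose r a := f a - comb 0 f a.
have rT0 a : a \notin T0 -> r a = 0 by move=> aT; rewrite /r flow_comb_coord ?subrr.
have bdyr w : bdy G D r w = 0.
  by rewrite bdyB flowf bdy_flow_comb mul0rn if_same subr0.
have r2 : r e0 *+ 2 = 0.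
  have := sum_bdy r orD; rewrite big1 => [|w _]; last exact: bdyr.
  rewrite (bigD1 e0) //= big1 ?addr0 => [|a /andP[aN ae]].
    by rewrite /sgn; case: (D _) => /esym; rewrite ?mulrN1z ?mulNrn // => /eqP;
      rewrite oppr_eq0 => /eqP.
  by rewrite rT0 ?mul0rz ?mul0rn // in_setU1 negb_or ae (contraTN _ aN) // => /(disjointFr posT)->.
(* As [g e0] is 1 or -1, this is the coefficient for which [x *~ g e0] equals [r e0]. *)
pose x := r e0 *~ g e0.
have x2 : x *+ 2 = 0 by rewrite /x pmulrn mulrzAC -pmulrn r2 mul0rz.
have r0 : (fun a => r a - vscale x g a) =1 fun=> 0.
  apply: (forest_flow_eq0 (D := D) forT) => [w|a aT].
    rewrite bdyB bdyr bdy_vscale root_vector_bdy sub0r.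
    by case: ifP; rewrite ?mulr0z ?oppr0 // -pmulrn x2 oppr0.
  rewrite vscaleE; have [->|ae] := eqVneq a e0.
    by rewrite /x -mulrzA root_vector_sq mulr1z subrr.
  have aT0 : a \notin T0 by rewrite in_setU1 negb_or ae.
  by rewrite rT0 // root_vector_supp // mulr0z subrr.
exists x; first by rewrite inE x2.
exists f; apply/ffunP => a; have /eqP := r0 a; rewrite subr_eq0 /r subr_eq !flow_combE.
by rewrite vscaleE mul0rz add0r => /eqP.
Qed.

(** [comb] ignores the values of [c] on [T0]; the representatives vanishing there parametrize each
    class injectively and can be counted. *)
Let coords : {set {ffun E -> Gam}} := [set c in pffun_on 0 (mem (~: T0)) predT].

Let flow_comb_coords x c : exists2 c', c' \in coords & comb x c = comb x c'.
Proof.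
exists [ffun e => if e \in T0 then 0 else c e].
  rewrite inE; apply/pffun_onP; split=> //; apply/supportP => e.
  by rewrite inE negbK ffunE => ->.
apply/ffunP => a; rewrite !flow_combE; congr (_ + _); apply: eq_bigr => e.
by rewrite in_setC => /negPf eT; rewrite [X in _ = X *~ _]ffunE eT.
Qed.

Let card_coords : #|coords| = (#|Gam| ^ (#|E| - #|V|))%N.
Proof.
rewrite cardsE card_pffun_on cardsCs setCK; congr (_ ^ (_ - _))%N.
rewrite cardsU1 -(spanning_tree_card v treeT).
by rewrite (contraTN _ e0N) // => /(disjointFr posT)->.
Qed.

Let coords_inj x x' c c' : c \in coords -> c' \in coords ->
  comb x c = comb x' c' -> x = x' /\ c = c'.
Proof.
rewrite !inE => /pffun_onP[/supportP s0 _] /pffun_onP[/supportP s1 _] /flow_comb_inj[-> eqc].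
split=> //; apply/ffunP => e; have [eT|/eqc//] := boolP (e \in T0).
by rewrite s0 ?s1 // inE negbK.
Qed.

Lemma flow_class_card (x : Gam) : #|flow_class G D T0 e0 v x| = (#|Gam| ^ (#|E| - #|V|))%N.
Proof.
have inj : {in coords &, injective (comb x)}.
  by move=> c c' cC c'C /(coords_inj cC c'C)[].
rewrite -card_coords -(card_in_imset inj).
apply: eq_card => f; apply/imsetP/imsetP => -[c].
  by have [c' c'C ->] := flow_comb_coords x c => _ ->; exists c'.
by move=> _ ->; exists c.
Qed.

Lemma flows_classes :
  flows G Gam D = \bigcup_(x in Gamma2 Gam) flow_class G D T0 e0 v x.
Proof.
apply/setP => f; rewrite inE; apply/idP/bigcupP => [/flow_is_comb[x xG [c ->]]|[x xG]].
  by exists x => //; apply: imset_f.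
by case/imsetP => c _ ->; apply: flow_comb_is_flow.
Qed.

Lemma flow_class_disjoint (x x' : Gam) : x != x' ->
  [disjoint flow_class G D T0 e0 v x & flow_class G D T0 e0 v x'].
Proof.
move=> neq; rewrite disjoint_subset; apply/subsetP => f /imsetP[c _ ->].
by rewrite inE; apply/imsetP => -[c' _ /flow_comb_inj[/eqP]]; rewrite (negPf neq).
Qed.

Lemma flows_card : #|flows G Gam D| = (#|Gamma2 Gam| * #|Gam| ^ (#|E| - #|V|))%N.
Proof.
have inj : {in setX (Gamma2 Gam) coords &, injective (fun p => comb p.1 p.2)}.
  move=> [x c] [x' c']; rewrite !in_setX => /andP[_ cC] /andP[_ c'C].
  by case/(coords_inj cC c'C) => /= -> ->.
rewrite -card_coords -cardsX -(card_in_imset inj).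
apply: eq_card => f; rewrite inE; apply/idP/imsetP.
  case/flow_is_comb => x xG [c ->]; have [c' c'C ->] := flow_comb_coords x c.
  by exists (x, c'); rewrite // in_setX xG.
by case=> -[x c]; rewrite in_setX => /andP[xG _] ->; apply: flow_comb_is_flow.
Qed.
End MainFlows.

(** [Gamma2] is an elementary abelian 2-group containing every subgroup isomorphic to a power of
    ['Z_2], so it attains the maximum defining [epsilon]. *)
Lemma card_Gamma2 (Gam : finZmodType) : #|Gamma2 Gam| = 2 ^ epsilon Gam.
Proof.
have grp : group_set (Gamma2 Gam).
  apply/group_setP; split; first by rewrite inE mul0rn.
  by move=> x y; rewrite !inE => /eqP x2 /eqP y2; rewrite mulrnDl x2 y2 addr0.
pose A := Group grp.
have abA : (2.-abelem A)%g.
  apply/abelemP => //; split; first by apply/centsP => x _ y _; apply: addrC.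
  by move=> x; rewrite inE => /eqP.
have abR d : (2.-abelem [set: 'rV['Z_2]_d])%g by apply: (@mx_Fp_abelem 2 1 d).
have cardR d : #|[set: 'rV['Z_2]_d]| = 2 ^ d by rewrite cardsT card_mx card_ord mul1n.
have isoA d (H : {group Gam}) : H \isog [set: 'rV['Z_2]_d] -> H \subset A /\ #|H| = 2 ^ d.
  move=> iso; split; last by rewrite (card_isog iso) cardR.
  have : (2.-abelem H)%g by rewrite (isog_abelem iso).
  case/abelemP => // _ H2; apply/subsetP => x /H2 x2; rewrite inE; exact/eqP.
have [d dA] : exists d, #|A| = 2 ^ d.
  by have /andP[/p_natP[d ->] _] := abA; exists d.
rewrite -[LHS]/#|A| dA; congr (_ ^ _)%N; apply/eqP; rewrite eqn_leq; apply/andP; split.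
  (* The exponent [d] lies in the range of the maximum because [d < 2 ^ d] and [2 ^ d] is the order
     of a subgroup. *)
  have ltd : d < #|Gam|.+1.
    rewrite ltnS (leq_trans (ltnW (ltn_expl d (ltnSn 1)))) // -dA; exact: max_card.
  apply: (@leq_bigmax_cond _ _ (fun d : 'I_#|Gam|.+1 => d : nat) (Ordinal ltd)).
  apply/existsP; exists A; rewrite (isog_abelem_card _ abA) abR cardR dA.
  by apply/eqP.
apply/bigmax_leqP => i /existsP[H /isoA[sub cH]].
by rewrite -(leq_exp2l (m := 2)) // -cH -dA subset_leq_card.
Qed.

Unset Implicit Arguments.

Theorem theorem4p1 (Gam : finZmodType) (k : nat) (hk : #|Gam| = k)
  (V E : finType) (n m : nat) (hn : #|V| = n) (hm : #|E| = m)
  (G : sgraph V E)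
  (Gconn : connected_graph G) (Gunb : unbalanced_graph G)
  (D : {ffun E * bool -> bool}) (Dor : orientation G [set: E] D)
  (T : {set E}) (Ttree : spanning_tree G T) (Tpos : [disjoint T & neg G])
  (e0 : E) (e0neg : e0 \in neg G)
  (T0 : {set E}) (T0def : T0 = e0 |: T)
  (v : V) (vC0 : v \in vset G (root_circuit G T0)) :
  [/\ forall (x x' : Gam) (c c' : {ffun E -> Gam}),
        x \in Gamma2 Gam -> x' \in Gamma2 Gam ->
        flow_comb G D T0 e0 v x c = flow_comb G D T0 e0 v x' c' ->
        x = x' /\ (forall e, e \notin T0 -> c e = c' e),
      #|flows G Gam D| = (2 ^ epsilon Gam * k ^ (m - n))%N &
      [/\ flows G Gam D =
            \bigcup_(x in Gamma2 Gam) flow_class G D T0 e0 v x,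
          forall x x' : Gam, x \in Gamma2 Gam -> x' \in Gamma2 Gam -> x != x' ->
            [disjoint flow_class G D T0 e0 v x & flow_class G D T0 e0 v x'] &
          forall x : Gam, x \in Gamma2 Gam ->
            #|flow_class G D T0 e0 v x| = (k ^ (m - n))%N]].
Proof.
subst k n m T0; split.
- by move=> x x' c c' _ _; apply: flow_comb_inj.
- by rewrite (flows_card Dor Ttree Tpos e0neg vC0) card_Gamma2.
split.
- exact: flows_classes.
- by move=> x x' _ _; apply: flow_class_disjoint.
- by move=> x _; apply: flow_class_card.
Qed.
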